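(* Let $\mathfrak D=\mathrm{Scat}(\mathfrak D_{\rm in})$ for the standard initial diagram $\mathfrak D_{\rm in}=\{(f_i^\perp,\Psi_{q^{1/d_i}}(z^{f_i})):i\in I\setminus F\}$, and consider the classical ($q^{1/D}=1$) theta functions. For any prime $p$, any $u\in\mathcal N$, and any generic $Q$, one has $\vartheta_{u,Q}^p\equiv\vartheta_{pu,Q}\pmod p$, i.e. every coefficient of $\vartheta_{u,Q}^p-\vartheta_{pu,Q}$ (as a formal Laurent series in $z^n$, $n\in\mathcal N$) is an integer divisible by $p$.
   Context: Setup: lattice $\mathcal N$ with dual $\mathcal M$, basis $\{f_i\}_{i\in I}$, $F\subset I$; skew-symmetric $\mathbb Q$-valued form $\omega$, $\pi_1(n)=\omega(n,\cdot)$; $d_i>0$ rational with $d_i\pi_1(f_i)\in\mathcal M$; $\Psi_q(x)=\prod_{a\ge1}(1+q^{2a-1}x)^{-1}$. $\mathrm{Scat}(\mathfrak D_{\rm in})$ is the unique-up-to-equivalence consistent scattering diagram over the quantum torus Lie algebra (spanned by $\hat z^n=z^n/(q-q^{-1})$, $n$ a nonzero nonnegative combination of $f_i$, $i\notin F$, with $z^{n_1}z^{n_2}=q^{\omega(n_1,n_2)}z^{n_1+n_2}$) containing $\mathfrak D_{\rm in}$ with all other walls outgoing. Theta functions $\vartheta_{u,Q}$ at a generic point $Q$ are sums of final monomials of broken lines with ends $(u,Q)$ (start at infinity with $z^u$, travel in direction $-\pi_1$ of the current exponent, and at walls replace the monomial by a monomial term of its image under the wall-crossing automorphism; $\vartheta_{u,Q}=z^u$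 if $u\in\ker\pi_1$). The classical theta functions are the $q^{1/D}\to1$ limits; in the classical limit, the commutative Laurent series ring is used and crossing the initial wall $f_i^\perp$ acts by $z^n\mapsto z^n(1+z^{f_i})^{d_i\omega(n,f_i)}$. It is known (Gross–Hacking–Keel–Kontsevich) that the classical diagram can be chosen so that each wall-crossing acts by $z^n\mapsto z^n(1+z^{f})^{k}$ with $k\in\mathbb Z_{\ge0}$ (depending on $n$) and that classical theta functions have integer coefficients. *)

(* Defs.v *)
From HB Require Import structures.
From mathcomp Require Import all_boot all_order all_algebra.
From mathcomp Require Import boolp classical_sets fsbigop reals.

Set Implicit Arguments.
Unset Strict Implicit.
Unset Printing Implicit Defensive.

Import Order.TTheory GRing.Theory Num.Theory.
Local Open Scope ring_scope.

(* Lattice N = Z^r with basis f_i (unit vectors), dual M; M_R = R^r.   *)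

Definition lat (r : nat) := {ffun 'I_r -> int}.
Definition pt (R : realType) (r : nat) := 'I_r -> R.

Definition ser := nat -> rat.
Definition smul (s t : ser) : ser := fun j => \sum_(i < j.+1) s i * t (j - i)%N.
Fixpoint spow (s : ser) (k : nat) : ser :=
  match k with
  | 0 => fun j => (j == 0%N)%:R
  | k'.+1 => smul s (spow s k')
  end.
Definition binomQ (a : rat) (k : nat) : rat :=
  (\prod_(i < k) (a - i%:R)) / (k`!)%:R.
(* j-th coefficient of g^a = sum_k binom(a,k) (g-1)^k, for g with g_0 = 1 *)
Definition gpow (a : rat) (g : ser) (j : nat) : rat :=
  \sum_(k < j.+1) binomQ a k * spow (fun i => if i == 0%N then 0 else g i) k j.

(* finite formal sums  sum c z^n  (n in N), as lists of terms *)
Definition poly (r : nat) := seq (lat r * rat).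

Section Defs.
Context (R : realType) (r : nat) (F : {set 'I_r}) (om : 'I_r -> 'I_r -> rat).

Local Notation lat := (lat r).
Local Notation pt := (pt R r).
Local Notation poly := (poly r).

Definition deg (n : lat) : int := \sum_(i | i \notin F) n i.
Definition omega (n n' : lat) : rat :=
  \sum_i \sum_j (n i)%:~R * (n' j)%:~R * om i j.
Definition pi1Q (n : lat) (j : 'I_r) : rat := \sum_i (n i)%:~R * om i j.
Definition pi1 (n : lat) : pt := fun j => ratr (pi1Q n j).
Definition pairR (n : lat) (m : pt) : R := \sum_i (n i)%:~R * m i.

(* A (classical) wall: normal n0 in N^+, support
     d = { m | <n0,m> = 0, <a,m> >= 0 for a in wineq }
   (a rational polyhedral cone in n0^perp) and a series g in z^{n0} with
   constant term 1.  Crossing d from the side <n0,.> > 0 to the side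
   <n0,.> < 0 acts by  z^n |-> z^n g^{omega(n,n0)}  (classical limit of
   the Lie-algebra wall element), the opposite crossing by the inverse. *)
Record wall := Wall { wn : lat; wineq : seq lat; wg : ser }.

Definition in_supp (w : wall) (m : pt) : bool :=
  (pairR (wn w) m == 0) && all (fun a => 0 <= pairR a m) (wineq w).

Definition relint (w : wall) (m : pt) : Prop :=
  in_supp w m /\ exists e : R, 0 < e /\
    forall m' : pt, pairR (wn w) m' = 0 ->
      (forall i, `|m' i - m i| < e) -> in_supp w m'.

Definition nontriv (w : wall) : Prop := exists j, (0 < j)%N /\ wg w j != 0.
Definition trivial_mod (k : nat) (w : wall) : Prop :=
  forall j, (0 < j)%N -> j%:Z * deg (wn w) <= k%:Z -> wg w j = 0.
Definition nontriv_modb (k : nat) (w : wall) : bool :=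
  has (fun j => [&& (0 < j)%N, j%:Z * deg (wn w) <= k%:Z & wg w j != 0])
      (iota 0 k.+1).

Definition wall_ok (w : wall) : Prop :=
  [/\ (forall i, 0 <= wn w i), (forall i, i \in F -> wn w i = 0),
      (exists i, wn w i != 0), wg w 0%N = 1 & (exists m, relint w m)].

(* A scattering diagram: countably many walls, together with a bound
   dbnd k beyond which all walls are trivial modulo degree > k
   (= finiteness of D_k). *)
Record diagram := Diagram { dw : nat -> wall; dbnd : nat -> nat }.

Definition scat_ok (D : diagram) : Prop :=
  (forall i, wall_ok (dw D i)) /\
  (forall k i, (dbnd D k <= i)%N -> trivial_mod k (dw D i)).

Definition parallel (n n' : lat) : Prop := forall i j, n i * n' j = n j * n' i.

Definition Sing (D : diagram) (m : pt) : Prop :=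
  (exists i, [/\ nontriv (dw D i), in_supp (dw D i) m & ~ relint (dw D i) m]) \/
  (exists i j, [/\ nontriv (dw D i), nontriv (dw D j),
       ~ parallel (wn (dw D i)) (wn (dw D j)), in_supp (dw D i) m
     & in_supp (dw D j) m]).

Definition Q_generic (D : diagram) (Q : pt) : Prop :=
  forall i, nontriv (dw D i) -> ~~ in_supp (dw D i) Q.

Definition pcoef (p : poly) (v : lat) : rat := \sum_(x <- p | x.1 == v) x.2.
Definition pmul (p q : poly) : poly :=
  [seq (x.1 + y.1, x.2 * y.2) | x <- p, y <- q].
Definition pone : poly := [:: (0, 1)].
Definition ptpow (a : rat) (w : wall) (k : nat) : poly :=
  [seq (wn w *+ j, gpow a (wg w) j) | j <- iota 0 k.+1].
(* wall crossing with sign s (+1: from <n0,.> > 0 to < 0), applied to a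
   finite sum of monomials, keeping terms z^{n + j n0} with j <= k *)
Definition apply_wall (w : wall) (s : rat) (k : nat) (p : poly) : poly :=
  [seq (x.1 + wn w *+ j, x.2 * gpow (s * omega x.1 (wn w)) (wg w) j)
     | x <- p, j <- iota 0 k.+1].

Definition seg (a b : pt) (t : R) : pt := fun i => a i + t * (b i - a i).
Definition active (D : diagram) (k i : nat) : bool :=
  (i < dbnd D k)%N && nontriv_modb k (dw D i).
Definition cross_time (n : lat) (a b : pt) : R :=
  pairR n a / (pairR n a - pairR n b).
Definition crossedb (D : diagram) (a b : pt) (i : nat) : bool :=
  let n := wn (dw D i) in
  (pairR n a * pairR n b < 0) && in_supp (dw D i) (seg a b (cross_time n a b)).

Definition gen_seg (D : diagram) (k : nat) (a b : pt) : Prop :=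
  [/\ (forall i, active D k i -> ~~ in_supp (dw D i) a /\ ~~ in_supp (dw D i) b),
      (forall i, active D k i -> forall t, 0 <= t <= 1 ->
          in_supp (dw D i) (seg a b t) -> relint (dw D i) (seg a b t)),
      (forall i j, active D k i -> active D k j ->
          ~ parallel (wn (dw D i)) (wn (dw D j)) -> forall t, 0 <= t <= 1 ->
          ~ (in_supp (dw D i) (seg a b t) /\ in_supp (dw D j) (seg a b t)))
    & (forall i, active D k i ->
          (exists t, 0 <= t <= 1 /\ in_supp (dw D i) (seg a b t)) ->
          pairR (wn (dw D i)) b != pairR (wn (dw D i)) a)].

Definition seg_cross (D : diagram) (k : nat) (a b : pt) (p : poly) : poly :=
  let L := sort (fun i j => cross_time (wn (dw D i)) a b
                            <= cross_time (wn (dw D j)) a b)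
                [seq i <- iota 0 (dbnd D k) | active D k i && crossedb D a b i] in
  foldl (fun q i => apply_wall (dw D i)
                      (if 0 < pairR (wn (dw D i)) a then 1 else -1) k q) p L.

Definition pt0 : pt := fun _ => 0.

Definition path_prod (D : diagram) (k : nat) (pts : seq pt) (p : poly) : poly :=
  foldl (fun q j => seg_cross D k (nth pt0 pts j) (nth pt0 pts j.+1) q)
        p (iota 0 (size pts).-1).

Definition consistent (D : diagram) : Prop :=
  forall (k : nat) (pts : seq pt), (2 <= size pts)%N ->
    head pt0 pts = last pt0 pts ->
    (forall j, (j < (size pts).-1)%N ->
        gen_seg D k (nth pt0 pts j) (nth pt0 pts j.+1)) ->
    forall n v : lat, deg v <= deg n + k%:Z ->
      pcoef (path_prod D k pts [:: (n, 1)]) v = (v == n)%:R.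

Definition fvec (i : 'I_r) : lat := [ffun j => (j == i)%:Z].
(* classical limit of (f_i^perp, Psi_{q^{1/d_i}}(z^{f_i})):
   crossing acts by z^n |-> z^n (1 + z^{f_i})^{d_i omega(n,f_i)},
   i.e. g = (1 + z^{f_i})^{d_i} *)
Definition init_wall (d : 'I_r -> rat) (i : 'I_r) : wall :=
  Wall (fvec i) [::] (fun j => binomQ (d i) j).

Definition wall_equiv (w w' : wall) : Prop :=
  [/\ wn w = wn w', (forall m, in_supp w m = in_supp w' m) & (forall j, wg w j = wg w' j)].

Definition outgoing (w : wall) : bool := ~~ in_supp w (pi1 (wn w)).

Definition contains_init_outgoing (d : 'I_r -> rat) (D : diagram) : Prop :=
  exists ix : 'I_r -> nat,
    [/\ (forall i i', i \notin F -> i' \notin F -> ix i = ix i' -> i = i'),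
        (forall i, i \notin F -> wall_equiv (dw D (ix i)) (init_wall d i))
      & (forall j, (forall i, i \notin F -> j <> ix i) ->
           nontriv (dw D j) -> outgoing (dw D j))].

(* A broken line for u with end Q: exponents u = m_0, m_1, ..., m_s
   (ms = [m_1;...;m_s]) and bend times t_1 < ... < t_s < 0 (ts).
   On the j-th domain of linearity (t_j, t_{j+1}) (t_0 = -oo, t_{s+1} = 0)
   the monomial is c_j z^{m_j} and L' = -pi1(m_j); L(0) = Q. *)
Definition bl := (seq lat * seq R)%type.

Definition bl_exp (u : lat) (b : bl) (j : nat) : lat := nth u (u :: b.1) j.
Definition bl_end (b : bl) (j : nat) : R :=
  if (j < size b.1)%N then nth 0 b.2 j else 0.
Definition bl_len (b : bl) (j : nat) (t : R) : R :=
  if j == 0%N then Num.max 0 (bl_end b 0 - t)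
  else Num.max 0 (bl_end b j - Num.max t (nth 0 b.2 j.-1)).
Definition bl_pos (Q : pt) (u : lat) (b : bl) (t : R) : pt :=
  fun i => Q i + \sum_(j < (size b.1).+1) bl_len b j t * pi1 (bl_exp u b j) i.

(* coefficient factor at the k-th bend: the coefficient of
   z^{m_{k+1} - m_k} in prod_{walls d containing L(t_{k+1})} g_d^{|omega(m_k,n_d)|}
   (this is the wall-crossing in the direction of travel -pi1(m_k)) *)
Definition bl_kappa (D : diagram) (Q : pt) (u : lat) (b : bl) (k : nat) : rat :=
  let m := bl_exp u b k in
  let v := bl_exp u b k.+1 - m in
  let dv := `|deg v|%N in
  let P := bl_pos Q u b (nth 0 b.2 k) in
  pcoef (foldr pmul pone
           [seq ptpow `|omega m (wn (dw D i))| (dw D i) dv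
              | i <- iota 0 (dbnd D dv) & in_supp (dw D i) P]) v.

Definition bl_coef (D : diagram) (Q : pt) (u : lat) (b : bl) : rat :=
  \prod_(k < size b.1) bl_kappa D Q u b k.

Definition bl_valid (D : diagram) (Q : pt) (u : lat) (b : bl) : Prop :=
  [/\ size b.2 = size b.1, sorted <%R b.2, all (fun t => t < 0) b.2,
      (forall k, (k < size b.1)%N ->
          bl_exp u b k.+1 != bl_exp u b k /\ bl_kappa D Q u b k != 0)
    & (forall t, t <= 0 -> ~ Sing D (bl_pos Q u b t))].

Definition theta_coef (D : diagram) (Q : pt) (u v : lat) : rat :=
  if [forall j, pi1Q u j == 0] then (v == u)%:R
  else \sum_(b \in [set b : bl | bl_valid D Q u b /\ bl_exp u b (size b.1) = v])
          bl_coef D Q u b.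

Definition theta_pow_coef (D : diagram) (Q : pt) (u : lat) (p : nat) (v : lat) : rat :=
  \sum_(x \in [set x : p.-tuple lat | \sum_(y <- x) y = v])
     \prod_(y <- x) theta_coef D Q u y.

End Defs.

(* Main.v *)
Require Import Defs.
From HB Require Import structures.
From mathcomp Require Import all_boot all_order all_algebra.
From mathcomp Require Import fingroup perm action cyclic.
From mathcomp Require Import ring lra zify.
From mathcomp Require Import boolp classical_sets functions cardinality fsbigop reals.
Set Implicit Arguments.
Unset Strict Implicit.
Unset Printing Implicit Defensive.
Import Order.TTheory GRing.Theory Num.Theory.
Local Open Scope ring_scope.

(* Crossing the walls through a point P sends z^m to z^m G for a series G = G(P, m),
   and the bend coefficients of broken lines are coefficients of such G.

   Integrality. All coefficients of G are integers, by induction on the degree k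
   of the exponent v. By consistency the crossings along a generic loop compose
   to the identity; modulo Z the coefficient of z^(m + v) in the composition is
   the sum of the coefficients of z^v in those crossings whose wall lies in
   v^perp, since every other term is a product of integers of smaller degree.
   A loop crossing v^perp near P and near pi_1(v) therefore identifies, up to
   sign and modulo Z, the coefficient at P with the one near pi_1(v). Outgoing
   walls avoid pi_1 of their normal, so the latter involves only an initial wall,
   whose functions (1 + z^{f_i})^{d_i omega(m, f_i)} have integer exponents.

   Congruence. Multiplying exponents by p and dividing times by p maps broken
   lines for u to broken lines for pu with the same bend points. Replacing m by
   pm replaces G by G^p, whose coefficient of z^w is congruent modulo p to the
   coefficient of z^(w/p) in G if p divides w, and to 0 otherwise. Hence
   rescaled lines have congruent coefficients, and broken lines for pu that are
   not rescaled ones contribute multiples of p. Likewise the p-th power of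
   theta_u is congruent to the sum of its terms with exponents multiplied by p. *)

(** Single walls carry no integrality: a function may be distributed over several walls with
    overlapping supports, and the exponents [omega m n_d] are rational. Consistency constrains only
    the product G over all walls through a point, so integrality is stated for G alone. Away from
    the singular locus the walls through a point have parallel normals with nonnegative coordinates.
    Their crossings therefore commute, and the numbers [omega m n_d] share one sign, so the absolute
    values in the bend coefficients only replace m by -m. The integrality statement ranges over all
    m at once, because a composition of crossings starts each new crossing at a shifted exponent.
    G(P, pm) = G(P, m)^p comes from linearity of [omega] in m. Since a diagram is finite only modulo
    degree > k, products and crossings carry a truncation level k; their coefficients of degree at
    most k do not depend on the level, which lets the induction on degree move between levels. *)

Local Notation lpoly := Defs.poly.

(** * Binomial series with rational exponents *)

Lemma binomQ0 a : binomQ a 0 = 1.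
Proof. by rewrite /binomQ big_ord0 fact0 divr1. Qed.

Lemma binomQS a k : k.+1%:R * binomQ a k.+1 = (a - k%:R) * binomQ a k.
Proof.
rewrite /binomQ big_ord_recr /= factS natrM.
have h1 : (k.+1%:R : rat) != 0 by rewrite pnatr_eq0.
have h2 : (k`!%:R : rat) != 0 by rewrite pnatr_eq0 -lt0n fact_gt0.
by field; rewrite h2 nat1r h1.
Qed.

Lemma binomQ0n k : binomQ 0 k = (k == 0%N)%:R.
Proof.
case: k => [|k]; first by rewrite binomQ0.
by rewrite /binomQ big_ord_recl subr0 !mul0r.
Qed.

Lemma binomQ_vandermonde a b k :
  binomQ (a + b) k = \sum_(i < k.+1) binomQ a i * binomQ b (k - i)%N.
Proof.
elim: k => [|k IH]; first by rewrite big_ord1 !binomQ0 mulr1.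
have h1 : (k.+1%:R : rat) != 0 by rewrite pnatr_eq0.
apply: (mulfI h1); rewrite binomQS IH.
(* The factor k+1 is split as i + (k+1-i), so that [binomQS] applies to the first binomial in one
   half and to the second in the other. *)
have -> : k.+1%:R * \sum_(i < k.+2) binomQ a i * binomQ b (k.+1 - i)%N =
   \sum_(i < k.+2) (i%:R * binomQ a i) * binomQ b (k.+1 - i)%N +
   \sum_(i < k.+2) binomQ a i * ((k.+1 - i)%:R * binomQ b (k.+1 - i)%N).
  rewrite mulr_sumr -big_split; apply: eq_bigr => i _ /=.
  have -> : (k.+1%:R : rat) = i%:R + (k.+1 - i)%:R.
    by rewrite -natrD subnKC // -ltnS.
  ring.
rewrite [X in _ = X + _]big_ord_recl /= mulr0n !mul0r add0r [X in _ = _ + X]big_ord_recr /= subnn mulr0n mul0r mulr0 addr0.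
rewrite -big_split mulr_sumr; apply: eq_bigr => i _ /=.
have hi : (i <= k)%N by rewrite -ltnS.
rewrite /bump leq0n add1n subSS binomQS subSn // binomQS.
have -> : (k%:R : rat) = i%:R + (k - i)%:R by rewrite -natrD subnKC.
ring.
Qed.

Lemma binomQ1 k : binomQ 1 k = (k <= 1)%:R.
Proof.
case: k => [|[|k]]; first by rewrite binomQ0.
  by rewrite /binomQ big_ord1 subr0 factS fact0 muln1 divr1.
by rewrite /binomQ big_ord_recl big_ord_recl /= subrr mul0r mulr0 mul0r.
Qed.

Lemma binomQ_pascal a k : binomQ (a + 1) k.+1 = binomQ a k.+1 + binomQ a k.
Proof.
rewrite binomQ_vandermonde 2!big_ord_recr /= subnn subSn // subnn.
rewrite !binomQ1 !mulr1 big1 ?add0r 1?addrC // => i _.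
rewrite binomQ1 (_ : (_ <= 1)%N = false) ?mulr0 //.
by apply/negbTE; rewrite -ltnNge; have := ltn_ord i; lia.
Qed.

Lemma binomQ_int a k : a \is a Num.int -> binomQ a k \is a Num.int.
Proof.
move=> /intrP[m ->]; elim: m k => [|m IH|m IH] k.
- by rewrite binomQ0n rpred_nat.
- case: k => [|k]; first by rewrite binomQ0.
  by rewrite -addn1 PoszD intrD binomQ_pascal rpredD.
- elim: k => [|k IHk]; first by rewrite binomQ0.
  have -> : binomQ (- m.+1%:Z)%:~R k.+1 =
     binomQ (- m%:Z)%:~R k.+1 - binomQ (- m.+1%:Z)%:~R k.
    have -> : ((- m%:Z)%:~R : rat) = (- m.+1%:Z)%:~R + 1.
      by rewrite -[1]/(1%:~R) -intrD; congr (_%:~R); lia.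
    by rewrite binomQ_pascal; ring.
  by rewrite rpredB.
Qed.

Lemma spow_coef (s : ser) K k j : (j <= K)%N ->
  spow s k j = ((\poly_(i < K.+1) s i) ^+ k)`_j.
Proof.
elim: k j => [|k IH] j hj; first by rewrite expr0 coef1.
rewrite exprS coefM /= /smul; apply: eq_bigr => i _.
have hi := ltn_ord i.
rewrite coef_poly IH ?(leq_trans (leq_subr _ _)) //.
by rewrite (_ : (i < K.+1)%N) // (leq_trans hi).
Qed.

(** Without constant term, [H ^+ i] starts in degree [i], so the terms with i > j do not reach the
    coefficient [j]. *)
Lemma coef_comp_low (C H : {poly rat}) j : H`_0 = 0 ->
  (C \Po H)`_j = \sum_(i < j.+1) C`_i * (H ^+ i)`_j.
Proof.
move=> H0.
have low i k : (k < i)%N -> (H ^+ i)`_k = 0.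
  elim: i k => // i IH k hk; rewrite exprS coefM big1 // => l _.
  case: (posnP l) => [->|l0]; first by rewrite H0 mul0r.
  by rewrite IH ?mulr0 //; have := ltn_ord l; lia.
rewrite comp_polyE coef_sum.
under eq_bigr do rewrite coefZ.
rewrite -(big_mkord xpredT (fun i => C`_i * (H ^+ i)`_j)).
rewrite -(big_mkord xpredT (fun i => C`_i * (H ^+ i)`_j)).
have [h|h] := leqP (size C) j.+1.
  rewrite [RHS](big_cat_nat _ h) //= [X in _ + X]big_nat_cond [X in _ + X]big1 ?addr0 //.
  by move=> i /andP[/andP[hi _] _]; rewrite nth_default ?mul0r.
rewrite (big_cat_nat _ (ltnW h)) //= [X in _ + X]big_nat_cond [X in _ + X]big1 ?addr0 //.
by move=> i /andP[/andP[hi _] _]; rewrite low ?mulr0.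
Qed.

(** Rational powers become compositions of truncated polynomials, where [comp_polyM] is
    available. *)
Lemma gpow_comp_poly (a : rat) (g : ser) K j : (j <= K)%N ->
  gpow a g j = ((\poly_(k < K.+1) binomQ a k) \Po
                (\poly_(i < K.+1) (if i == 0%N then 0 else g i)))`_j.
Proof.
move=> hj; rewrite coef_comp_low ?coef_poly //; apply: eq_bigr => k _.
rewrite -spow_coef // coef_poly (_ : (k < K.+1)%N) //.
by rewrite (leq_trans (ltn_ord k)).
Qed.

(** Vandermonde multiplies the outer binomial polynomials, and composition with the fixed inner
    polynomial is multiplicative. *)
Lemma gpowD (a b : rat) (g : ser) j :
  gpow (a + b) g j = \sum_(i < j.+1) gpow a g i * gpow b g (j - i)%N.
Proof.
transitivity (((\poly_(k < j.+1) binomQ a k * \poly_(k < j.+1) binomQ b k) \Po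
                (\poly_(i < j.+1) (if i == 0%N then 0 else g i)))`_j).
  rewrite (@gpow_comp_poly _ _ j) // !coef_comp_low ?coef_poly //.
  apply: eq_bigr => i _; congr (_ * _).
  have hi := ltn_ord i.
  rewrite coef_poly hi coefM binomQ_vandermonde; apply: eq_bigr => l _.
  have hl := ltn_ord l.
  by rewrite !coef_poly !ifT //; lia.
rewrite comp_polyM coefM; apply: eq_bigr => i _.
have hi := ltn_ord i.
by rewrite -!gpow_comp_poly //; lia.
Qed.

Lemma gpow0 (g : ser) j : gpow 0 g j = (j == 0%N)%:R.
Proof.
rewrite /gpow big_ord_recl binomQ0 mul1r big1 ?addr0 // => i _.
by rewrite binomQ0n mul0r.
Qed.

Lemma gpow_coef0 a (g : ser) : gpow a g 0 = 1.
Proof. by rewrite /gpow big_ord1 binomQ0 mul1r. Qed.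

Lemma gpow1 (g : ser) j : g 0%N = 1 -> gpow 1 g j = g j.
Proof.
move=> g0; rewrite /gpow big_ord_recl binomQ0 mul1r /=.
case: j => [|j]; first by rewrite big_ord0 addr0.
rewrite big_ord_recl big1 ?addr0 /= => [|i _].
  rewrite binomQ1 mul1r add0r /= /smul big_ord_recr /= subnn mulr1 big1 ?add0r //.
  move=> i _; have hi := ltn_ord i.
  by rewrite (_ : (j.+1 - _ == 0)%N = false) ?mulr0 //=; lia.
by rewrite binomQ1 mul0r.
Qed.

Lemma gpow_triv a (g : ser) j : (0 < j)%N ->
  (forall i, (0 < i <= j)%N -> g i = 0) -> gpow a g j = 0.
Proof.
move=> j0 hg; rewrite /gpow big1 // => k _.
rewrite (_ : spow _ _ _ = 0) ?mulr0 //.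
have : forall l, (l <= j)%N ->
   spow (fun i => if i == 0%N then 0 else g i) k l = ((k == 0%N :> nat) && (l == 0%N))%:R.
  case: (nat_of_ord k) => [|k'] l hl; first by [].
  rewrite andFb /= /smul big1 // => i _.
  case: ifP => [_|/negbT i0]; first by rewrite mul0r.
  by rewrite hg ?mul0r //; have := ltn_ord i; lia.
by move=> ->//; rewrite (gtn_eqF j0) andbF.
Qed.

(** For an initial wall, with function (1 + x)^d, this merges the two rational exponents into one
    product, which turns out to be an integer. *)
Lemma gpow_binomQ (a d : rat) j : gpow a (binomQ d) j = binomQ (a * d) j.
Proof.
have hnat (m : nat) i : gpow m%:R (binomQ d) i = binomQ (m%:R * d) i.
  elim: m i => [|m IH] i; first by rewrite gpow0 mul0r binomQ0n.
  rewrite -natr1 gpowD mulrDl mul1r binomQ_vandermonde; apply: eq_bigr => l _.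
  by rewrite IH gpow1 // binomQ0.
(* Both sides are polynomials in [a], so it suffices to compare them at [a] natural. *)
pose bp (k : nat) : {poly rat} := (k`!%:R)^-1 *: \prod_(i < k) ('X - i%:R%:P).
have bpE x k : (bp k).[x] = binomQ x k.
  rewrite /bp hornerZ horner_prod mulrC /binomQ; congr (_ / _).
  by apply: eq_bigr => i _; rewrite !hornerE.
pose P : {poly rat} := \sum_(k < j.+1) spow (fun i => if i == 0%N then 0 else binomQ d i) k j *: bp k
   - (bp j \Po (d *: 'X)).
have PE x : P.[x] = gpow x (binomQ d) j - binomQ (x * d) j.
  rewrite /P hornerD hornerN horner_comp bpE hornerZ hornerX (mulrC d) horner_sum; congr (_ - _).
  by apply: eq_bigr => k _; rewrite hornerZ bpE mulrC.
have P0 : P = 0.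
  apply/eqP/negP => /negP Pn0.
  pose rs : seq rat := [seq i%:R | i <- iota 0 (size P)].
  have hall : all (root P) rs.
    by apply/allP => x /mapP[i _ ->]; rewrite /root PE hnat subrr.
  have hu : uniq rs.
    by rewrite map_inj_uniq ?iota_uniq // => x y /eqP; rewrite eqr_nat => /eqP.
  by have := max_poly_roots Pn0 hall hu; rewrite size_map size_iota ltnn.
by apply/eqP; rewrite -subr_eq0 -PE P0 horner0.
Qed.

(** * Products of wall functions *)

Section Pcoef.
Context (r : nat).
Implicit Types (p q : lpoly r) (v w : lat r) (h : lat r -> rat).

Lemma pcoefE p v : pcoef p v = \sum_(x <- p) (if x.1 == v then x.2 else 0).
Proof. by rewrite /pcoef big_mkcond. Qed.

Lemma pcoef_nil v : pcoef ([::] : lpoly r) v = 0.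
Proof. by rewrite /pcoef big_nil. Qed.

Lemma pcoef_cons x p v : pcoef (x :: p) v = (if x.1 == v then x.2 else 0) + pcoef p v.
Proof. by rewrite !pcoefE big_cons. Qed.

Lemma pcoef_mon (n : lat r) c v : pcoef [:: (n, c)] v = if n == v then c else 0.
Proof. by rewrite pcoef_cons pcoef_nil addr0. Qed.

Lemma pcoef_one v : pcoef (pone r) v = (v == 0)%:R.
Proof. by rewrite pcoef_mon eq_sym; case: eqP. Qed.

Lemma pcoef_neq0 p v : pcoef p v != 0 -> exists2 x, x \in p & x.1 = v.
Proof.
elim: p => [|x p IH]; first by rewrite pcoef_nil eqxx.
rewrite pcoef_cons; case: (x.1 =P v) => [<- _|_]; first by exists x; rewrite ?mem_head.
by rewrite add0r => /IH[y yp yv]; exists y; rewrite // in_cons yp orbT.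
Qed.

(** A list of terms may repeat exponents. Regrouping makes sums over lists depend on [pcoef] only,
    and [S] may miss exponents where [h] vanishes. *)
Lemma sum_collect p (S : seq (lat r)) h : uniq S ->
  (forall x, x \in p -> h x.1 != 0 -> x.1 \in S) ->
  \sum_(x <- p) x.2 * h x.1 = \sum_(y <- S) pcoef p y * h y.
Proof.
move=> uS hS.
under [RHS]eq_bigr do rewrite pcoefE mulr_suml.
rewrite exchange_big; apply: eq_big_seq => x xp /=.
have [/eqP h0|h0] := boolP (h x.1 == 0).
  rewrite h0 mulr0 big1 // => y _; case: eqP => [<-|_]; by rewrite ?h0 ?mulr0 ?mul0r.
rewrite (bigD1_seq x.1) ?hS //= eqxx big1 ?addr0 // => y /negbTE ny.
by rewrite eq_sym ny mul0r.
Qed.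

Lemma sum_pcoef_congr p q h :
  (forall v, h v != 0 -> pcoef p v = pcoef q v) ->
  \sum_(x <- p) x.2 * h x.1 = \sum_(x <- q) x.2 * h x.1.
Proof.
move=> hpq; pose S := undup (map fst p ++ map fst q).
rewrite (@sum_collect p S) ?undup_uniq //; last first.
  by move=> x xp _; rewrite mem_undup mem_cat (map_f fst xp).
rewrite (@sum_collect q S) ?undup_uniq //; last first.
  by move=> x xp _; rewrite mem_undup mem_cat (map_f fst xp) orbT.
apply: eq_bigr => v _; have [/eqP->|/hpq->//] := boolP (h v == 0).
by rewrite !mulr0.
Qed.

Lemma pcoef_pmul p q v :
  pcoef (pmul p q) v = \sum_(x <- p) x.2 * pcoef q (v - x.1).
Proof.
rewrite pcoefE /pmul big_allpairs_dep; apply: eq_bigr => x _ /=.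
rewrite pcoefE mulr_sumr; apply: eq_bigr => y _ /=.
have -> : (y.1 == v - x.1) = (x.1 + y.1 == v) by rewrite eq_sym subr_eq eq_sym addrC.
by case: eqP => // _; rewrite mulr0.
Qed.

Lemma pcoef_pmulC p q v : pcoef (pmul p q) v = pcoef (pmul q p) v.
Proof.
rewrite !pcoefE /pmul !big_allpairs_dep exchange_big; apply: eq_bigr => x _ /=.
by apply: eq_bigr => y _ /=; rewrite addrC mulrC.
Qed.

Lemma pcoef_pmulA p q s v : pcoef (pmul p (pmul q s)) v = pcoef (pmul (pmul p q) s) v.
Proof.
rewrite !pcoefE /pmul !big_allpairs_dep; apply: eq_bigr => x _ /=.
rewrite !big_allpairs_dep; apply: eq_bigr => y _ /=; apply: eq_bigr => z _ /=.
by rewrite addrA mulrA.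
Qed.

Lemma pcoef_pmul1 p v : pcoef (pmul (pone r) p) v = pcoef p v.
Proof. by rewrite pcoef_pmul big_seq1 /= mul1r subr0. Qed.

End Pcoef.

(** * The cone of exponents and its degree *)

Section Cone.
Context (r : nat) (F : {set 'I_r}).
Implicit Types (p q : lpoly r) (v w : lat r).

Definition cone v := [forall i, (0 <= v i) && ((i \in F) ==> (v i == 0))].

Lemma coneP v :
  reflect ((forall i, 0 <= v i) /\ (forall i, i \in F -> v i = 0)) (cone v).
Proof.
apply: (iffP forallP) => [h|[h1 h2] i].
  split=> i; have /andP[h1 /implyP h2] := h i => // iF; exact/eqP/h2.
by rewrite h1; apply/implyP => /h2->.
Qed.

Lemma cone0 : cone 0.
Proof. by apply/coneP; split=> i; rewrite ffunE. Qed.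

Lemma coneD v w : cone v -> cone w -> cone (v + w).
Proof.
move=> /coneP[a b] /coneP[c d]; apply/coneP; split=> i; rewrite ffunE ?addr_ge0 //.
by move=> iF; rewrite b ?d.
Qed.

Lemma coneMn v n : cone v -> cone (v *+ n).
Proof. by move=> cv; elim: n => [|n IH]; rewrite ?mulr0n ?cone0 // mulrS coneD. Qed.

Lemma degD v w : deg F (v + w) = deg F v + deg F w.
Proof. by rewrite /deg -big_split; apply: eq_bigr => i _; rewrite ffunE. Qed.

Lemma deg0 : deg F (0 : lat r) = 0.
Proof. by rewrite /deg big1 // => i _; rewrite ffunE. Qed.

Lemma degN v : deg F (- v) = - deg F v.
Proof. by apply/eqP; rewrite -addr_eq0 -degD addNr deg0. Qed.

Lemma degB v w : deg F (v - w) = deg F v - deg F w.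
Proof. by rewrite degD degN. Qed.

Lemma degMn v n : deg F (v *+ n) = deg F v *+ n.
Proof. by elim: n => [|n IH]; rewrite ?mulr0n ?deg0 // !mulrS degD IH. Qed.

Lemma deg_ge0 v : cone v -> 0 <= deg F v.
Proof. by move=> /coneP[h _]; rewrite /deg sumr_ge0. Qed.

Lemma cone_deg0 v : cone v -> deg F v = 0 -> v = 0.
Proof.
move=> /coneP[h1 h2] /eqP; rewrite /deg psumr_eq0 // => /allP h; apply/ffunP => i.
rewrite ffunE; case: (boolP (i \in F)) => iF; first exact: h2.
by have /implyP /(_ iF) /eqP := h i (mem_index_enum _).
Qed.

Lemma deg_gt0 v : cone v -> v != 0 -> 0 < deg F v.
Proof.
move=> cv; rewrite lt_def deg_ge0 // andbT; apply: contra_neq; exact: cone_deg0.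
Qed.

Definition in_cone p := all (fun x => cone x.1) p.

Lemma in_coneP p x : in_cone p -> x \in p -> cone x.1.
Proof. by move=> /allP h /h. Qed.

Lemma pcoef_cone p v : in_cone p -> pcoef p v != 0 -> cone v.
Proof. by move=> cp /pcoef_neq0[x xp <-]; exact: in_coneP cp xp. Qed.

Lemma in_cone_one : in_cone (pone r).
Proof. by rewrite /in_cone /= cone0. Qed.

Lemma in_cone_pmul p q : in_cone p -> in_cone q -> in_cone (pmul p q).
Proof.
move=> cp cq; apply/allP => x /allpairsP[[y z] /= [yp zq ->]] /=.
by rewrite coneD ?(in_coneP cp yp) ?(in_coneP cq zq).
Qed.

(** Degrees in the cone are nonnegative and additive, so a product in degree at most [K] sees only
    the parts of its factors of degree at most [K]. *)
Lemma pmul_congr (K : int) p q p' q' :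
  in_cone p -> in_cone q -> in_cone p' -> in_cone q' ->
  (forall v, deg F v <= K -> pcoef p v = pcoef p' v) ->
  (forall v, deg F v <= K -> pcoef q v = pcoef q' v) ->
  forall v, deg F v <= K -> pcoef (pmul p q) v = pcoef (pmul p' q') v.
Proof.
move=> cp cq cp' cq' hp hq v hv.
transitivity (pcoef (pmul p q') v).
  rewrite !pcoef_pmul; apply: eq_big_seq => x xp; congr (_ * _); apply: hq.
  by rewrite degB lerBlDr (le_trans hv) // lerDl (deg_ge0 (in_coneP cp xp)).
rewrite !pcoef_pmul; apply: (sum_pcoef_congr (h := fun y => pcoef q' (v - y))) => y hy.
by apply: hp; apply: le_trans hv; rewrite -subr_ge0 -degB (deg_ge0 (pcoef_cone cq' hy)).
Qed.

End Cone.

Section WallProducts.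
Context (R : realType) (r : nat) (F : {set 'I_r}) (om : 'I_r -> 'I_r -> rat) (D : diagram r).
Hypothesis hD : scat_ok R F D.
Implicit Types (p q : lpoly r) (v w n : lat r) (i k : nat).

Local Notation W := (dw D).
Local Notation cone := (cone F).
Local Notation deg := (deg F).

Lemma wn_cone i : cone (wn (W i)).
Proof. by case: hD => /(_ i)[h1 h2 _ _ _] _; apply/coneP. Qed.

Lemma wn_neq0 i : wn (W i) != 0.
Proof.
case: hD => /(_ i)[_ _ [j hj] _ _] _; apply: contraNneq hj => ->; by rewrite ffunE.
Qed.

Lemma deg_wn i : 0 < deg (wn (W i)).
Proof. by rewrite deg_gt0 ?wn_cone ?wn_neq0. Qed.

(** This is [active] without the bound on the index, which [scat_ok] makes automatic ([activeE]). *)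
Definition act (k i : nat) : bool := nontriv_modb F k (W i).

Lemma act_lt k i : act k i -> (i < dbnd D k)%N.
Proof.
apply: contraTT; rewrite -leqNgt => /(proj2 hD) h.
apply/hasPn => j _; apply/negP => /and3P[j0 jk /eqP]; apply; exact: h.
Qed.

Lemma activeE k i : active F D k i = act k i.
Proof. by rewrite /active andb_idl // => /act_lt. Qed.

Lemma act_mono k l i : (k <= l)%N -> act k i -> act l i.
Proof.
move=> kl /hasP[j]; rewrite mem_iota => /andP[_ jk] /and3P[j0 hj gj].
apply/hasP; exists j; first by rewrite mem_iota; lia.
by rewrite j0 gj (le_trans hj).
Qed.

Lemma act_nontriv k i : act k i -> nontriv (W i).
Proof. by move=> /hasP[j _ /and3P[j0 _ gj]]; exists j. Qed.

Lemma Nact_wg k i j : ~~ act k i -> (0 < j)%N -> deg (wn (W i)) *+ j <= k%:Z -> wg (W i) j = 0.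
Proof.
move=> /hasPn h j0 hj; apply/eqP/negPn/negP => gj.
have hdj : j%:Z * deg (wn (W i)) <= k%:Z by rewrite mulrC -natz mulr_natr.
have jk : (j <= k)%N.
  have := deg_wn i; move: hdj; nia.
have := h j; rewrite mem_iota /= add0n ltnS jk => /(_ isT).
by rewrite j0 hdj gj.
Qed.

(** Truncated product of the g_i^(a i). The [foldr] form makes it convertible to the product inside
    [bl_kappa]. *)
Definition wprod (a : nat -> rat) (k : nat) (L : seq nat) : lpoly r :=
  foldr (@pmul r) (pone r) [seq ptpow (a i) (W i) k | i <- L].

Lemma in_cone_ptpow a k i : in_cone F (ptpow a (W i) k).
Proof. by apply/allP => x /mapP[j _ ->] /=; rewrite coneMn ?wn_cone. Qed.

Lemma in_cone_wprod a k L : in_cone F (wprod a k L).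
Proof.
elim: L => [|i L IH]; first exact: in_cone_one.
exact: in_cone_pmul (in_cone_ptpow _ _ _) IH.
Qed.

Lemma pcoef_ptpow0 a k i : pcoef (ptpow a (W i) k) 0 = 1.
Proof.
rewrite /ptpow /= pcoef_cons /= mulr0n eqxx gpow_coef0 pcoefE big_map big_seq big1 ?addr0 // => j.
rewrite mem_iota => /andP[j1 _] /=; case: eqP => // h.
have := deg_wn i; have : deg (wn (W i)) *+ j = 0 by rewrite -degMn h deg0.
by move/eqP; rewrite mulrn_eq0; lia.
Qed.

Lemma pcoef_ptpow a k i v j : v = wn (W i) *+ j -> deg v <= k%:Z ->
  pcoef (ptpow a (W i) k) v = gpow a (wg (W i)) j.
Proof.
move=> vj hv.
have hd := deg_wn i.
have inj l : (wn (W i) *+ l == v) = (l == j).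
  apply/eqP/eqP => [|->//]; rewrite vj => /(congr1 deg); rewrite !degMn => h.
  exact: (mulrIn (lt0r_neq0 hd)) h.
have jk : (j < k.+1)%N.
  by move: hv; rewrite vj degMn; nia.
rewrite pcoefE big_map.
under eq_bigr do rewrite /= inj.
rewrite (bigD1_seq j) ?iota_uniq ?mem_iota //= eqxx big1 ?addr0 // => l /negbTE->//.
Qed.

Lemma pcoef_ptpow_not a k i v : (forall j, v <> wn (W i) *+ j) -> pcoef (ptpow a (W i) k) v = 0.
Proof.
move=> h; rewrite pcoefE big_map big1 // => j _ /=; case: eqP => // e; case: (h j); by rewrite e.
Qed.

Lemma ptpow_level a k l i v : deg v <= k%:Z -> deg v <= l%:Z ->
  pcoef (ptpow a (W i) k) v = pcoef (ptpow a (W i) l) v.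
Proof.
move=> hk hl; case: (pselect (exists j, v = wn (W i) *+ j)) => [[j vj]|h].
  by rewrite !(pcoef_ptpow _ vj).
by rewrite !pcoef_ptpow_not // => j e; apply: h; exists j.
Qed.

Lemma ptpow_Nact a k d i v : ~~ act d i -> deg v <= d%:Z -> deg v <= k%:Z ->
  pcoef (ptpow a (W i) k) v = pcoef (pone r) v.
Proof.
move=> na hd hk; rewrite pcoef_one.
case: (pselect (exists j, v = wn (W i) *+ j)) => [[j vj]|h]; last first.
  rewrite pcoef_ptpow_not; last by move=> j e; apply: h; exists j.
  by case: eqP => // v0; case: h; exists 0%N; rewrite mulr0n.
rewrite (pcoef_ptpow _ vj) //.
case: (posnP j) vj => [->|j0] vj; first by rewrite vj mulr0n eqxx gpow_coef0.
rewrite gpow_triv //; last first.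
  move=> l /andP[l0 lj]; apply: (Nact_wg na l0); apply: le_trans hd.
  by rewrite vj degMn -(mulr_natr _ l) -(mulr_natr _ j) ler_wpM2l ?ler_nat // ltW // deg_wn.
case: eqP => // v0; have := deg_wn i; have := congr1 deg vj; rewrite v0 deg0 degMn.
by move/eqP; rewrite eq_sym mulrn_eq0; lia.
Qed.

Lemma wprod_level a k l L v : deg v <= k%:Z -> deg v <= l%:Z ->
  pcoef (wprod a k L) v = pcoef (wprod a l L) v.
Proof.
move=> hk hl; elim: L v hk hl => [|i L IH] v hk hl //.
apply: (@pmul_congr _ F (Num.min k%:Z l%:Z)); rewrite ?in_cone_ptpow ?in_cone_wprod //.
- by move=> w; rewrite le_min => /andP[]; exact: ptpow_level.
- by move=> w; rewrite le_min => /andP[]; exact: IH.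
- by rewrite le_min hk.
Qed.

(** A wall inactive at level [d] has function 1 up to degree [d]. *)
Lemma wprod_filter a k d L v : (d <= k)%N -> deg v <= d%:Z ->
  pcoef (wprod a k L) v = pcoef (wprod a k (filter (act d) L)) v.
Proof.
move=> dk; elim: L v => [|i L IH] v hv //=.
case: (boolP (act d i)) => hi.
  apply: (@pmul_congr _ F d%:Z); rewrite ?in_cone_ptpow ?in_cone_wprod //.
rewrite -IH // -[RHS]pcoef_pmul1.
apply: (@pmul_congr _ F d%:Z); rewrite ?in_cone_ptpow ?in_cone_wprod ?in_cone_one //.
by move=> w hw; apply: (ptpow_Nact _ hi) => //; lia.
Qed.

Lemma pcoef_wprod0 a k L : pcoef (wprod a k L) 0 = 1.
Proof.
rewrite (@wprod_filter a k 0%N) ?deg0 // (@eq_filter _ (act 0) pred0) //.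
by rewrite filter_pred0 /wprod /= pcoef_one eqxx.
Qed.

(** [gpowD] wall by wall, followed by a rearrangement of the factors. The degree bound is that of
    the truncation. *)
Lemma wprodD a b k L v : deg v <= k%:Z ->
  pcoef (wprod (fun i => a i + b i) k L) v = pcoef (pmul (wprod a k L) (wprod b k L)) v.
Proof.
elim: L v => [|i L IH] v hv; first by rewrite /wprod /= pcoef_pmul1.
transitivity (pcoef (pmul (pmul (ptpow (a i) (W i) k) (ptpow (b i) (W i) k)) (pmul (wprod a k L) (wprod b k L))) v).
  apply: (@pmul_congr _ F k%:Z); rewrite ?(in_cone_pmul, in_cone_ptpow, in_cone_wprod) //.
  move=> w hw.
  case: (pselect (exists j, w = wn (W i) *+ j)) => [[j wj]|h]; last first.
    rewrite pcoef_ptpow_not; last by move=> j e; apply: h; exists j.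
    apply/esym/eqP/negPn/negP => /pcoef_neq0[x /allpairsP[[y z] /= [/mapP[j _ ->] /mapP[l _ ->] ->]] /=].
    by move=> e; apply: h; exists (j + l)%N; rewrite mulrnDr.
  rewrite (pcoef_ptpow _ wj) // gpowD pcoef_pmul big_map.
  have jk : (j <= k)%N.
    by have := deg_wn i; move: hw; rewrite wj degMn; nia.
  rewrite -(big_mkord xpredT (fun l => gpow (a i) (wg (W i)) l * gpow (b i) (wg (W i)) (j - l)%N)).
  rewrite -[iota 0 k.+1]/(index_iota 0 k.+1).
  (* Indices past [j] leave an exponent of negative degree, which no factor contains. *)
  rewrite (@big_cat_nat _ _ _ j.+1 0 k.+1) //= [X in _ = _ + X]big_nat_cond [X in _ = _ + X]big1 ?addr0; last first.
    move=> l /andP[/andP[jl _] _]; apply/eqP; rewrite mulf_eq0; apply/orP; right.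
    apply/negPn/negP => /(pcoef_cone (in_cone_ptpow _ _ _)) /deg_ge0.
    rewrite wj degB !degMn; have := deg_wn i; nia.
  rewrite !big_nat; apply: eq_bigr => l /andP[_ lj]; congr (_ * _).
  have e : w - wn (W i) *+ l = wn (W i) *+ (j - l) by rewrite wj mulrnBr.
  rewrite (pcoef_ptpow _ e) //.
  rewrite e degMn; move: hw; rewrite wj degMn; have := deg_wn i; nia.
pose pa := ptpow (a i) (W i) k; pose pb := ptpow (b i) (W i) k.
rewrite /wprod /= -/(wprod a k L) -/(wprod b k L) -/pa -/pb.
have pmulcR (x y z : lpoly r) : (forall u, pcoef y u = pcoef z u) -> forall u, pcoef (pmul x y) u = pcoef (pmul x z) u.
  by move=> e u; rewrite !pcoef_pmul; apply: eq_bigr => t _; rewrite e.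
rewrite -!pcoef_pmulA; apply: (pmulcR) => u.
rewrite pcoef_pmulC -pcoef_pmulA; apply: pmulcR => u'.
exact: pcoef_pmulC.
Qed.

End WallProducts.

(** * Compositions of wall crossings *)

Section Omega.
Context (r : nat) (om : 'I_r -> 'I_r -> rat).
Implicit Types (v w n m : lat r).
Local Notation omega := (omega om).

Lemma omegaDl m n w : omega (m + n) w = omega m w + omega n w.
Proof.
rewrite /Defs.omega -big_split; apply: eq_bigr => i _ /=.
rewrite -big_split; apply: eq_bigr => j _ /=.
by rewrite ffunE intrD; ring.
Qed.

Lemma omegaMl n w (k : nat) : omega (n *+ k) w = k%:R * omega n w.
Proof.
elim: k => [|k IH]; last by rewrite mulrS omegaDl IH -[in RHS]nat1r; ring.
rewrite mul0r /Defs.omega big1 // => i _; rewrite big1 // => j _.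
by rewrite mulr0n ffunE !mul0r.
Qed.

Lemma omegaNl n w : omega (- n) w = - omega n w.
Proof.
apply/eqP; rewrite -addr_eq0 -omegaDl addNr.
by rewrite -(mulr0n n) omegaMl mul0r.
Qed.

Lemma omega_pi1Q n w : omega n w = \sum_j (w j)%:~R * pi1Q om n j.
Proof.
rewrite /Defs.omega exchange_big; apply: eq_bigr => j _ /=.
by rewrite /pi1Q mulr_sumr; apply: eq_bigr => i _; ring.
Qed.

Hypothesis om_skew : forall i j, om i j = - om j i.

Lemma omega_parallel n w : parallel n w -> omega n w = 0.
Proof.
move=> par; suff: omega n w = - omega n w by lra.
rewrite {1}/Defs.omega exchange_big /Defs.omega -sumrN; apply: eq_bigr => i _ /=.
rewrite -sumrN; apply: eq_bigr => j _ /=.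
by rewrite -!intrM par om_skew mulrN.
Qed.

End Omega.

Section Crossings.
Context (R : realType) (r : nat) (F : {set 'I_r}) (om : 'I_r -> 'I_r -> rat) (D : diagram r).
Hypothesis hD : scat_ok R F D.
Implicit Types (p q : lpoly r) (v w n : lat r) (i k : nat) (L : seq (rat * nat)).

Local Notation W := (dw D).
Local Notation cone := (cone F).
Local Notation deg := (deg F).

Definition crosses k L q : lpoly r :=
  foldl (fun q c => apply_wall om (W c.2) c.1 k q) q L.

(** A matrix entry of the composite crossing. It is indexed by the shift [w] because the shift,
    unlike the exponent [n + w], lies in the cone. *)
Definition ker k L n w : rat := pcoef (crosses k L [:: (n, 1)]) (n + w).

Lemma sum_apply_wall i s k q (h : lat r -> rat) :
  \sum_(x <- apply_wall om (W i) s k q) x.2 * h x.1 =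
  \sum_(x <- q) x.2 * \sum_(y <- ptpow (s * omega om x.1 (wn (W i))) (W i) k) y.2 * h (x.1 + y.1).
Proof.
rewrite /apply_wall big_allpairs_dep; apply: eq_bigr => x _.
rewrite mulr_sumr big_map; apply: eq_bigr => j _ /=; ring.
Qed.

Lemma crosses_cons k c L q :
  crosses k (c :: L) q = crosses k L (apply_wall om (W c.2) c.1 k q).
Proof. by []. Qed.

Lemma pcoef_crosses k L q v :
  pcoef (crosses k L q) v = \sum_(x <- q) x.2 * pcoef (crosses k L [:: (x.1, 1)]) v.
Proof.
elim: L q v => [|c L IH] q v.
  rewrite pcoefE; apply: eq_bigr => x _.
  by rewrite /= pcoef_mon; case: eqP; rewrite ?mulr1 ?mulr0.
pose h y := pcoef (crosses k L [:: (y, 1)]) v.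
rewrite crosses_cons IH (sum_apply_wall _ _ _ _ h); apply: eq_bigr => x _.
by rewrite crosses_cons IH (sum_apply_wall _ _ _ _ h) big_seq1 mul1r.
Qed.

Lemma crosses_cat k L1 L2 q : crosses k (L1 ++ L2) q = crosses k L2 (crosses k L1 q).
Proof. by rewrite /crosses foldl_cat. Qed.

Lemma crosses_supp k L q n : (forall x, x \in q -> cone (x.1 - n)) ->
  forall x, x \in crosses k L q -> cone (x.1 - n).
Proof.
elim: L q => [|c L IH] q hq //=; apply: IH => x.
move=> /allpairsP[[y j] /= [yq _ ->]] /=.
by rewrite addrAC coneD ?hq // coneMn // (wn_cone hD).
Qed.

Lemma ker_cone k L n w : ker k L n w != 0 -> cone w.
Proof.
move=> /pcoef_neq0[x xq xw]; have := @crosses_supp k L [:: (n, 1)] n.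
move=> /(_ _ _ xq); rewrite xw addrC addKr; apply => y.
by rewrite inE => /eqP-> /=; rewrite subrr cone0.
Qed.

(** Matrix multiplication over intermediate shifts. [S] may exceed the support, so that chosen
    shifts such as 0 and [w] can be singled out. *)
Lemma ker_cat k L1 L2 n w (S : seq (lat r)) : uniq S ->
  (forall v, ker k L1 n v != 0 -> v \in S) ->
  ker k (L1 ++ L2) n w = \sum_(v <- S) ker k L1 n v * ker k L2 (n + v) (w - v).
Proof.
move=> uS hS; rewrite /ker crosses_cat pcoef_crosses.
pose S' := undup (map (fun x => x.1 - n) (crosses k L1 [:: (n, 1)]) ++ S).
rewrite (@sum_collect _ _ (map (+%R n) S') (fun y => pcoef (crosses k L2 [:: (y, 1)]) (n + w))).
- rewrite big_map (bigID (fun v => v \in S)) /= [X in _ + X]big1 ?addr0; last first.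
    by move=> v; case: (ker k L1 n v =P 0) => [|/eqP/hS->//]; rewrite /ker => ->; rewrite mul0r.
  rewrite -big_filter; have pS : perm_eq [seq v <- S' | v \in S] S.
    apply: uniq_perm => //; first by rewrite filter_uniq ?undup_uniq.
    by move=> v; rewrite mem_filter mem_undup mem_cat; case: (v \in S); rewrite ?orbT.
  rewrite (perm_big _ pS) /=.
  by apply: eq_bigr => v _; rewrite addrACA subrr addr0 // addrAC addrK // addrC.
- by rewrite map_inj_uniq ?undup_uniq //; exact: addrI.
- move=> x xq _; apply/mapP; exists (x.1 - n); last by rewrite addrC subrK.
  by rewrite mem_undup mem_cat; apply/orP; left; apply/mapP; exists x.
Qed.

Lemma ker0 k L n : ker k L n 0 = 1.
Proof.
elim/last_ind: L n => [|L c IH] n; first by rewrite /ker /= pcoef_mon addr0 eqxx.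
(* A nonzero first shift has positive degree and could only be undone by a shift of negative
   degree. *)
have step w : w != 0 -> ker k L n w * ker k [:: c] (n + w) (0 - w) = 0.
  move=> w0; apply/eqP/negPn/negP; rewrite mulf_eq0 negb_or => /andP[/ker_cone c1 /ker_cone].
  rewrite sub0r => /deg_ge0; have := deg_gt0 c1 w0; rewrite degN oppr_ge0.
  by move=> /lt_le_trans h /h; rewrite ltxx.
rewrite -cats1 (@ker_cat _ _ _ _ _ (undup (0 :: map (fun x => x.1 - n) (crosses k L [:: (n, 1)])))) ?undup_uniq //.
  rewrite (bigD1_seq 0) ?undup_uniq ?mem_undup ?mem_head //= IH mul1r big1 ?addr0 => [|w /step//].
  rewrite /ker /= subr0 !addr0 pcoefE /apply_wall big_allpairs_dep big_seq1.
  have := pcoef_ptpow0 hD (c.1 * omega om n (wn (W c.2))) k c.2.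
  rewrite pcoefE big_map => e1; rewrite -[RHS]e1; apply: eq_bigr => j _ /=.
  by rewrite mul1r -subr_eq0 addrAC subrr add0r.
move=> v; rewrite /ker mem_undup in_cons => /pcoef_neq0[x xq xv]; apply/orP; right.
by apply/mapP; exists x => //; rewrite xv addrC addKr.
Qed.

(* Any other contribution to [z^(n + w)] moves the exponent at both stages, and
   is a product of coefficients of degree smaller than [deg w]. *)
Lemma ker_cat_mod k L1 L2 n w : w != 0 ->
  (forall n' w', deg w' < deg w -> ker k L1 n' w' \is a Num.int) ->
  (forall n' w', deg w' < deg w -> ker k L2 n' w' \is a Num.int) ->
  ker k (L1 ++ L2) n w - (ker k L1 n w + ker k L2 n w) \is a Num.int.
Proof.
move=> w0 h1 h2.
pose S := undup (0 :: w :: map (fun x => x.1 - n) (crosses k L1 [:: (n, 1)])).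
rewrite (@ker_cat _ _ _ _ _ S) ?undup_uniq //; last first.
  move=> v; rewrite /ker mem_undup !in_cons => /pcoef_neq0[x xq xv].
  apply/orP; right; apply/orP; right.
  by apply/mapP; exists x => //; rewrite xv addrC addKr.
rewrite (bigD1_seq 0) ?undup_uniq ?mem_undup ?mem_head //=.
rewrite -big_filter (bigD1_seq w) ?filter_uniq ?undup_uniq //=; last first.
  by rewrite mem_filter w0 mem_undup !in_cons eqxx orbT.
rewrite ker0 mul1r addr0 subr0 subrr ker0 mulr1 big_filter_cond.
have e (x y z : rat) : x + (y + z) - (y + x) = z by ring.
rewrite e {e}.
apply: rpred_sum => v /andP[v0 vw].
have [/eqP->|k1] := boolP (ker k L1 n v == 0); first by rewrite mul0r rpred0.
have [/eqP->|k2] := boolP (ker k L2 (n + v) (w - v) == 0); first by rewrite mulr0 rpred0.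
have d1 : 0 < deg v by rewrite deg_gt0 ?(ker_cone k1).
have d2 : 0 < deg (w - v) by rewrite deg_gt0 ?(ker_cone k2) // subr_eq0 eq_sym.
apply: rpredM; first by apply: h1; rewrite -subr_gt0 -degB.
by apply: h2; rewrite degB ltrBlDr ltrDl.
Qed.

(** Lower degrees are needed for every exponent, since compositions mix them. In degree [k] the
    position of a path relative to v^perp gives information about [v] only. *)
Definition int_upto k v L :=
  forall n w, deg w < k%:Z \/ w = v -> ker k L n w \is a Num.int.

Lemma int_upto_nil k v : int_upto k v [::].
Proof.
move=> n w _; rewrite /ker /= pcoef_mon; case: ifP => // _; exact: rpred1.
Qed.

Lemma int_upto_cat k v L1 L2 : deg v = k%:Z ->
  int_upto k v L1 -> int_upto k v L2 -> int_upto k v (L1 ++ L2).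
Proof.
move=> dv h1 h2 n w hw.
have [->|w0] := eqVneq w 0; first by rewrite ker0 rpred1.
have hwk : deg w <= k%:Z by case: hw => [/ltW//|->]; rewrite dv.
rewrite -[ker _ _ _ _](subrK (ker k L1 n w + ker k L2 n w)).
rewrite rpredD ?(rpredD (h1 _ _ hw) (h2 _ _ hw)) //; apply: ker_cat_mod => // n' w' h.
  by apply: h1; left; apply: lt_le_trans hwk.
by apply: h2; left; apply: lt_le_trans hwk.
Qed.

(** Crossing one of these walls shifts the exponent by multiples of its normal, on which [omega]
    with the other normals vanishes. All crossings thus use the initial exponent, and their
    functions simply multiply. *)
Lemma ker_parallel k (s : nat -> rat) (L : seq nat) n w :
  {in L &, forall i j, omega om (wn (W i)) (wn (W j)) = 0} ->
  ker k [seq (s i, i) | i <- L] n w =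
  pcoef (wprod D (fun i => s i * omega om n (wn (W i))) k L) w.
Proof.
move=> par.
suff H q v : pcoef (crosses k [seq (s i, i) | i <- L] q) v =
   \sum_(x <- q) x.2 * pcoef (wprod D (fun i => s i * omega om x.1 (wn (W i))) k L) (v - x.1).
  by rewrite /ker H big_seq1 mul1r /= addrC addKr.
elim: L par q v => [|i L IH] par q v.
  rewrite pcoefE; apply: eq_bigr => x _ /=; rewrite pcoef_one subr_eq0 eq_sym.
  by case: eqP; rewrite ?mulr1 ?mulr0.
rewrite /= IH; last by move=> a b ha hb; apply: par; rewrite in_cons ?ha ?hb orbT.
rewrite (sum_apply_wall _ _ _ _ (fun y => pcoef (wprod D (fun j => s j * omega om y (wn (W j))) k L) (v - y))).
apply: eq_bigr => x _; congr (_ * _).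
rewrite /wprod /= -/(wprod D (fun i => s i * omega om x.1 (wn (W i))) k L) pcoef_pmul.
rewrite !big_map; apply: eq_bigr => j _ /=; rewrite opprD addrA; congr (_ * pcoef _ _).
rewrite /wprod; congr foldr; apply/eq_in_map => l lL; congr ptpow.
by rewrite omegaDl omegaMl par ?mulr0 ?addr0 ?mem_head // in_cons lL orbT.
Qed.

End Crossings.

(* Walls crossed at the same time have to be treated together: only the
   product of their functions is integral. *)
Lemma sorted_key_ind (R : realType) (key : nat -> R) (P : seq nat -> Prop) :
  P [::] -> (forall L1 L2, P L1 -> P L2 -> P (L1 ++ L2)) ->
  forall L, sorted (fun i j => key i <= key j) L ->
  (forall t, P [seq i <- L | key i == t]) -> P L.
Proof.
move=> P0 Pcat L; have [N] := ubnP (size L); elim: N L => // N IH [//|i L] sz sL hP.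
have tr : transitive (fun i j => key i <= key j) by move=> a b c; exact: le_trans.
pose L' := i :: L; rewrite -/L' in sL hP *.
have hmin j : j \in L' -> key i <= key j.
  rewrite /L' in_cons => /orP[/eqP->//|]; move: sL; rewrite /L' /= path_sortedE // => /andP[/allP h _].
  exact: h.
(* As [L'] is sorted and [key i] is minimal, the first key class is a prefix. *)
have -> : L' = [seq j <- L' | key j == key i] ++ [seq j <- L' | key j != key i].
  have : {in L', forall j, key i <= key j} by [].
  elim: L' sL {hP sz hmin} => // a M IHM sM hm /=.
  have sM' : sorted (fun i j => key i <= key j) M by exact: path_sorted sM.
  have hM : {in M, forall j, key i <= key j} by move=> j jM; apply: hm; rewrite in_cons jM orbT.
  case: eqVneq => e /=; first by rewrite -IHM.
  suff allne : all (fun j => key j != key i) M.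
    rewrite [X in X ++ _](_ : _ = [::]) /=; first by congr cons; rewrite (all_filterP allne).
    rewrite (@eq_in_filter _ _ pred0) ?filter_pred0 // => j /(allP allne) /negbTE//.
  apply/allP => j jM; move: sM; rewrite /= path_sortedE // => /andP[/allP/(_ j jM) h _].
  rewrite gt_eqF //; apply: lt_le_trans h; rewrite lt_neqAle eq_sym e.
  by apply: hm; rewrite mem_head.
apply: Pcat; first exact: hP.
apply: IH.
- have -> : [seq j <- L' | key j != key i] = [seq j <- L | key j != key i] by rewrite /L' /= eqxx.
  by rewrite size_filter; have := count_size (fun j => key j != key i) L; move: sz => /=; lia.
- exact: sorted_filter.
- move=> t; rewrite -filter_predI.
  have [->|ti] := eqVneq t (key i).
    rewrite (@eq_filter _ _ pred0) ?filter_pred0 // => j /=; by case: eqP.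
  rewrite (@eq_filter _ _ (fun j => key j == t)) // => j /=.
  by case: eqP => // ->; rewrite ti.
Qed.

(** * Generic points and segments *)

Section Parallel.
Context (r : nat).
Implicit Types u v w : lat r.

Lemma parallel_sym v w : parallel v w -> parallel w v.
Proof. by move=> h i j; rewrite mulrC -h mulrC. Qed.

Lemma parallel_refl v : parallel v v.
Proof. by move=> i j; rewrite mulrC. Qed.

Lemma neq0_coord v : v != 0 -> exists i, v i != 0.
Proof.
move=> v0; apply: contrapT => h; move/eqP: v0; apply; apply/ffunP => i; rewrite ffunE.
by apply/eqP/negPn/negP => hi; apply: h; exists i.
Qed.

(** The middle vector has to be nonzero because 0 is parallel to everything; the square of a nonzero
    coordinate of it is cancelled. *)
Lemma parallel_trans v u w : v != 0 -> parallel u v -> parallel v w -> parallel u w.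
Proof.
move=> /neq0_coord[k vk] uv vw i j.
have vk2 : v k * v k != 0 by rewrite mulf_neq0.
apply: (mulIf vk2).
have e1 a : u a * v k = u k * v a by exact: uv.
have e2 a : w a * v k = w k * v a by rewrite mulrC -vw mulrC.
transitivity ((u k * v i) * (w k * v j)); first by rewrite -(e1 i) -(e2 j); ring.
transitivity ((u k * v j) * (w k * v i)); first by ring.
by rewrite -(e1 j) -(e2 i); ring.
Qed.

Lemma parallelD u v w : parallel u w -> parallel v w -> parallel (u + v) w.
Proof. by move=> h1 h2 i j; rewrite !ffunE !mulrDl h1 h2. Qed.

Lemma parallel0 w : parallel 0 w.
Proof. by move=> i j; rewrite !ffunE !mul0r. Qed.

Lemma parallelMn v (k : nat) w : parallel v w -> parallel (v *+ k) w.
Proof.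
by move=> h; elim: k => [|k IH]; [rewrite mulr0n; exact: parallel0|rewrite mulrS; exact: parallelD].
Qed.

End Parallel.

Section Geometry.
Context (R : realType) (r : nat).
Implicit Types (a b c x m : pt R r) (l : 'I_r -> R) (n v w : lat r).

Definition lin l x : R := \sum_i l i * x i.

Lemma linE n x : pairR n x = lin (fun i => (n i)%:~R) x.
Proof. by []. Qed.

Definition near c (P : pt R r -> Prop) :=
  exists e : R, 0 < e /\ forall x, (forall i, `|x i - c i| < e) -> P x.

Lemma nearT c P : (forall x, P x) -> near c P.
Proof. by exists 1. Qed.

Lemma near_and c P Q : near c P -> near c Q -> near c (fun x => P x /\ Q x).
Proof.
move=> [e [e0 h]] [e' [e'0 h']]; exists (Num.min e e'); rewrite lt_min e0 e'0; split=> // x hx.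
by split; [apply: h|apply: h'] => i; have := hx i; rewrite lt_min => /andP[].
Qed.

Lemma near_sub c (P Q : pt R r -> Prop) : (forall x, P x -> Q x) -> near c P -> near c Q.
Proof. by move=> h [e [e0 he]]; exists e; split=> // x /he /h. Qed.

Lemma near_all (I : eqType) (s : seq I) c (P : I -> pt R r -> Prop) :
  (forall i, i \in s -> near c (P i)) -> near c (fun x => forall i, i \in s -> P i x).
Proof.
elim: s => [|i s IH] h; first exact: nearT.
apply: (near_sub _ (near_and (h i _) (IH _))); rewrite ?mem_head //.
  by move=> x [h1 h2] j; rewrite in_cons => /orP[/eqP->|/h2].
by move=> j js; apply: h; rewrite in_cons js orbT.
Qed.

Lemma lin_dist l c x e : (forall i, `|x i - c i| <= e) ->
  `|lin l x - lin l c| <= (\sum_i `|l i|) * e.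
Proof.
move=> h; rewrite /lin -sumrB mulr_suml; apply: le_trans (ler_norm_sum _ _ _) _.
by apply: ler_sum => i _; rewrite -mulrBr normrM ler_wpM2l.
Qed.

Lemma near_lin_dist l c d : 0 < d -> near c (fun x => `|lin l x - lin l c| < d).
Proof.
move=> d0; pose M := \sum_i `|l i| + 1.
have M0 : 0 < M by rewrite ltr_wpDl // sumr_ge0.
exists (d / M); split; first by rewrite divr_gt0.
move=> x hx; have /le_lt_trans := lin_dist l (fun i => ltW (hx i)); apply.
by rewrite mulrA ltr_pdivrMr // mulrC ltr_pM2l // ltrDl.
Qed.

Lemma near_lin_gt0 l c : 0 < lin l c -> near c (fun x => 0 < lin l x).
Proof.
move=> h; apply: near_sub (near_lin_dist l c h) => x.
by rewrite ltr_norml => /andP[+ _]; rewrite ltrBrDl subrr.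
Qed.

Lemma near_lin_lt0 l c : lin l c < 0 -> near c (fun x => lin l x < 0).
Proof.
move=> h; have h' : 0 < - lin l c by rewrite oppr_gt0.
apply: near_sub (near_lin_dist l c h') => x.
by rewrite ltr_norml => /andP[_]; rewrite ltrBlDr addNr.
Qed.

Lemma near_lin_neq0 l c : lin l c != 0 -> near c (fun x => lin l x != 0).
Proof.
rewrite neq_lt => /orP[/near_lin_lt0|/near_lin_gt0]; apply: near_sub => x;
  by [apply: ltr0_neq0|apply: lt0r_neq0].
Qed.

Lemma near_not_supp (w : wall r) c : ~~ in_supp w c -> near c (fun x => ~~ in_supp w x).
Proof.
rewrite /in_supp negb_and => /orP[h|/allPn[a aw h]].
  by apply: near_sub (near_lin_neq0 h) => x hx; rewrite negb_and hx.
rewrite -ltNge in h; apply: near_sub (near_lin_lt0 h) => x hx.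
by rewrite negb_and; apply/orP; right; apply/allPn; exists a => //; rewrite -ltNge.
Qed.

Lemma near_near c e : 0 < e -> forall x, (forall i, `|x i - c i| < e) ->
  near x (fun y => forall i, `|y i - c i| < e).
Proof.
move=> e0 x hx.
have H i : near x (fun y => `|y i - c i| < e).
  exists (e - `|x i - c i|); rewrite subr_gt0; split=> // y /(_ i) hy.
  by rewrite -(subrK (x i) (y i)) -addrA (le_lt_trans (ler_normD _ _)) // -ltrBrDr.
apply: near_sub (@near_all _ (enum 'I_r) x (fun i y => `|y i - c i| < e) _) => // y h i.
by apply: h; rewrite mem_enum.
Qed.

(** Forms are treated one at a time: if the new one vanishes, a coordinate on which it depends is
    moved so little that the earlier forms stay nonzero. *)
Lemma exists_avoiding (J : eqType) (s : seq J) (l : J -> 'I_r -> R) c e : 0 < e ->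
  (forall j, j \in s -> exists i, l j i != 0) ->
  exists2 x, (forall i, `|x i - c i| < e) & forall j, j \in s -> lin (l j) x != 0.
Proof.
move=> e0; elim: s => [|j0 s IH] hs.
  by exists c => // i; rewrite subrr normr0.
have [|x xc hx] := IH; first by move=> j js; apply: hs; rewrite in_cons js orbT.
have [h|h] := eqVneq (lin (l j0) x) 0; last first.
  by exists x => // j; rewrite in_cons => /orP[/eqP->|/hx].
have [i0 li0] := hs j0 (mem_head _ _).
have := near_and (near_near e0 xc) (near_all (fun j js => near_lin_neq0 (hx j js))).
move=> [d [d0 hd]].
pose y : pt R r := fun i => x i + (i == i0)%:R * (d / 2).
have hy i : `|y i - x i| < d.
  rewrite /y addrAC subrr add0r; case: eqP => _; rewrite ?mul1r ?mul0r ?normr0 //.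
  by rewrite gtr0_norm ?divr_gt0 // ltr_pdivrMr // ltr_pMr // ltr1n.
have [yc ys] := hd y hy; exists y => // j; rewrite in_cons => /orP[/eqP->|/ys//].
have -> : lin (l j0) y = lin (l j0) x + l j0 i0 * (d / 2).
  rewrite /lin /y; under eq_bigr do rewrite mulrDr; rewrite big_split /=; congr (_ + _).
  rewrite (bigD1 i0) //= eqxx mul1r big1 ?addr0 // => i /negbTE->; by rewrite mul0r mulr0.
by rewrite h add0r !mulf_neq0 ?invr_neq0 ?(gt_eqF d0) ?pnatr_eq0 // gt_eqF.
Qed.

Lemma pairR_seg n a b t : pairR n (seg a b t) = pairR n a + t * (pairR n b - pairR n a).
Proof.
rewrite /pairR -sumrB mulr_sumr -big_split; apply: eq_bigr => i _ /=.
by rewrite /seg; ring.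
Qed.

Lemma parallel_pairR_eq0 n v m : n != 0 -> parallel n v -> pairR n m = 0 -> pairR v m = 0.
Proof.
move=> /neq0_coord[k nk] par h.
have : (n k)%:~R * pairR v m = (v k)%:~R * pairR n m.
  rewrite /pairR !mulr_sumr; apply: eq_bigr => i _; rewrite !mulrA -!intrM; congr (_%:~R * _).
  by rewrite (par k i) mulrC.
by rewrite h mulr0 => /eqP; rewrite mulf_eq0 intr_eq0 (negbTE nk) => /eqP.
Qed.

Lemma parallel_scale n v : (forall i, 0 <= n i) -> (forall i, 0 <= v i) ->
  n != 0 -> v != 0 -> parallel n v ->
  exists x y : int, [/\ 0 < x, 0 < y & forall i, n i * x = v i * y].
Proof.
move=> n0 v0 nn0 /neq0_coord[k vk] par.
exists (v k), (n k); split; first by rewrite lt_def vk v0.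
  rewrite lt_def n0 andbT; have /neq0_coord[j nj] := nn0.
  have := par j k; apply: contra_eqN => /eqP->; rewrite mul0r; exact: mulf_neq0.
by move=> i; rewrite par mulrC.
Qed.

(** Nonnegative coordinates make the ratio of the two vectors positive, so parallel walls are
    crossed from the same side. *)
Lemma parallel_sgr n v m : (forall i, 0 <= n i) -> (forall i, 0 <= v i) ->
  n != 0 -> v != 0 -> parallel n v -> Num.sg (pairR n m) = Num.sg (pairR v m).
Proof.
move=> n0 v0 nn0 vn0 par; have [x [y [x0 y0 h]]] := parallel_scale n0 v0 nn0 vn0 par.
have e : pairR n m * x%:~R = pairR v m * y%:~R.
  rewrite /pairR !mulr_suml; apply: eq_bigr => i _.
  by rewrite mulrAC -intrM h intrM mulrAC.
by move/(congr1 Num.sg): e; rewrite !sgrM (gtr0_sg (_ : 0 < x%:~R)) ?ltr0z // (gtr0_sg (_ : 0 < y%:~R)) ?ltr0z // !mulr1.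
Qed.

Definition genpt (S : seq (lat r)) a := forall n, n \in S -> n != 0 -> pairR n a != 0.
(* The span of [a] and [b] meets [n1^perp] and [n2^perp] simultaneously only at 0. *)
Definition genpair (S : seq (lat r)) a b := forall n1 n2, n1 \in S -> n2 \in S ->
  ~ parallel n1 n2 -> pairR n1 a * pairR n2 b != pairR n2 a * pairR n1 b.

Lemma genpair_sym S a b : genpair S a b -> genpair S b a.
Proof.
move=> h n1 n2 s1 s2 np; have := h _ _ s1 s2 np; apply: contra => /eqP e.
by rewrite mulrC [X in _ == X]mulrC -e eqxx.
Qed.

Lemma exists_generic S a b c e : 0 < e -> genpt S a -> genpt S b ->
  exists x, [/\ (forall i, `|x i - c i| < e), genpt S x, genpair S a x & genpair S b x].
Proof.
move=> e0 ga gb.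
pose tt (k : bool) := if k then a else b.
(* [genpair] against [a] or [b] says that these forms do not vanish at [x]. For nonparallel normals
   such a form is not zero, because [genpt] gives [pairR n2] a nonzero value at [a] and at [b]. In
   [l'], the tag [Some n] adds the forms of [genpt]. *)
pose l (j : bool * (lat r * lat r)) (i : 'I_r) : R :=
  (j.2.2 i)%:~R * pairR j.2.1 (tt j.1) - (j.2.1 i)%:~R * pairR j.2.2 (tt j.1).
pose s1 := [seq j <- [seq (k, nn) | k <- [:: true; false], nn <- [seq (n1, n2) | n1 <- S, n2 <- S]]
            | `[< ~ parallel j.2.1 j.2.2 >]].
pose l' (j : option (lat r) * (bool * (lat r * lat r))) : 'I_r -> R :=
  if j.1 is Some n then fun i => (n i)%:~R else l j.2.
pose s : seq (option (lat r) * (bool * (lat r * lat r))) :=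
  [seq (Some n, (true, (n, n))) | n <- S & n != 0] ++ [seq (None, j) | j <- s1].
have [j|x xc hx] := @exists_avoiding _ s l' c e e0.
  rewrite mem_cat => /orP[/mapP[n]|/mapP[[k [n1 n2]]]].
    by rewrite mem_filter => /andP[/neq0_coord[i ni] _] ->; exists i; rewrite /l' /= intr_eq0.
  rewrite mem_filter => /andP[/asboolP np hin] ->; move: np => /= np.
  have [S1 S2] : n1 \in S /\ n2 \in S.
    have /allpairsPdep[k' [q [_ q2 qe]]] := hin.
    have /allpairsPdep[m1 [m2 [q1' q2' qe']]] := q2.
    by move: qe; rewrite qe' => -[_ -> ->].
  have n20 : n2 != 0.
    by apply: contra_notN np => /eqP->; apply/parallel_sym/parallel0.
  have gk : genpt S (tt k) by case: (k).
  apply: contrapT => h; apply: np => i j'.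
  have z i' : (n2 i')%:~R * pairR n1 (tt k) = (n1 i')%:~R * pairR n2 (tt k).
    by apply/eqP; rewrite -subr_eq0; apply/negPn/negP => hz; apply: h; exists i'.
  have nz := gk _ S2 n20.
  apply: (@intr_inj R); rewrite !intrM; apply: (mulIf nz).
  by rewrite mulrAC -z [RHS]mulrAC -z; ring.
exists x; split=> //.
- move=> n nS n0; apply: (hx (Some n, (true, (n, n)))).
  by rewrite mem_cat map_f // mem_filter n0.
- move=> n1 n2 S1 S2 np; have := hx (None, (true, (n1, n2))).
  rewrite mem_cat (map_f _ (_ : (true, (n1, n2)) \in s1)) ?orbT; last first.
    rewrite mem_filter; apply/andP; split; first exact/asboolP.
    by rewrite !allpairs_f.
  move=> /(_ isT); apply: contra => /eqP h; rewrite /l' /l /lin /=.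
  under eq_bigr do rewrite mulrBl mulrAC [X in _ - X]mulrAC.
  by rewrite sumrB -!mulr_suml subr_eq0; apply/eqP; rewrite mulrC -/(pairR n2 x) h mulrC.
- move=> n1 n2 S1 S2 np; have := hx (None, (false, (n1, n2))).
  rewrite mem_cat (map_f _ (_ : (false, (n1, n2)) \in s1)) ?orbT; last first.
    rewrite mem_filter; apply/andP; split; first exact/asboolP.
    by rewrite !allpairs_f.
  move=> /(_ isT); apply: contra => /eqP h; rewrite /l' /l /lin /=.
  under eq_bigr do rewrite mulrBl mulrAC [X in _ - X]mulrAC.
  by rewrite sumrB -!mulr_suml subr_eq0; apply/eqP; rewrite mulrC -/(pairR n2 x) h mulrC.
Qed.

(** Inequalities parallel to the normal are equalities on the whole hyperplane; the others are
    strict at [m], hence also nearby. *)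
Lemma relint_of_generic (w : wall r) m : wn w != 0 -> in_supp w m ->
  (forall u : lat r, u \in wineq w -> ~ parallel (wn w) u -> pairR u m != 0) -> relint w m.
Proof.
move=> w0 hm hgen; split=> //.
have H (u : lat r) : u \in wineq w -> near m (fun x => pairR (wn w) x = 0 -> 0 <= pairR u x).
  move=> uw; case: (pselect (parallel (wn w) u)) => [par|npar].
    by apply: nearT => x hx; rewrite (parallel_pairR_eq0 w0 par hx).
  have : 0 < lin (fun i => (u i)%:~R) m.
    rewrite -linE lt_def hgen //; by move: hm => /andP[_ /allP]; apply.
  by move/near_lin_gt0; apply: near_sub => x /ltW.
have [e [e0 h]] := near_all H; exists e; split=> // x hx hd.
rewrite /in_supp hx eqxx; apply/allP => u uw; exact: h.
Qed.

Lemma genpair_seg S a b t n1 n2 : genpair S a b -> n1 \in S -> n2 \in S ->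
  ~ parallel n1 n2 -> pairR n1 (seg a b t) = 0 -> pairR n2 (seg a b t) = 0 -> False.
Proof.
move=> g s1 s2 np; rewrite !pairR_seg => h1 h2; move/eqP: (g _ _ s1 s2 np); apply.
move: h1 h2; set x1 := pairR n1 a; set x2 := pairR n2 a; set y1 := pairR n1 b; set y2 := pairR n2 b; move=> h1 h2.
(* The determinant is a combination of the two pairings with the point of the segment, both of which
   vanish. *)
have e : x1 * y2 - x2 * y1 = (x1 - y1) * (x2 + t * (y2 - x2)) + (y2 - x2) * (x1 + t * (y1 - x1)) by ring.
by apply/eqP; rewrite -subr_eq0 e h1 h2 !mulr0 addr0.
Qed.

End Geometry.

Lemma sorted_const_key (R : realType) (key : nat -> R) (t : R) (s : seq nat) :
  {in s, forall i, key i = t} -> sorted (fun i j => key i <= key j) s.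
Proof.
elim: s => // i [|j s] IH h //; rewrite /= !h ?inE ?eqxx ?orbT // lexx /=.
by apply: IH => l ls; apply: h; rewrite in_cons ls orbT.
Qed.

Section CrossTime.
Context (R : realType) (r : nat).
Implicit Types (a b c x y : pt R r) (n v : lat r).

Lemma seg_ball c e a b (t : R) : 0 <= t <= 1 -> (forall i, `|a i - c i| < e) ->
  (forall i, `|b i - c i| < e) -> forall i, `|seg a b t i - c i| < e.
Proof.
move=> /andP[t0 t1] ha hb i.
have -> : seg a b t i - c i = (1 - t) * (a i - c i) + t * (b i - c i) by rewrite /seg; ring.
have t1' : 0 <= 1 - t by rewrite subr_ge0.
rewrite (le_lt_trans (ler_normD _ _)) // !normrM (ger0_norm t0) (ger0_norm t1').
have := ha i; have := hb i; set X := `|a i - c i|; set Y := `|b i - c i| => hY hX.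
have [->|tn0] := eqVneq t 0; first by rewrite subr0 mul1r mul0r addr0.
have tp : 0 < t by rewrite lt_def tn0.
have h1 : t * Y < t * e by rewrite ltr_pM2l.
have h2 : (1 - t) * X <= (1 - t) * e by rewrite ler_wpM2l // ltW.
lra.
Qed.

Lemma cross_timeP n a b : pairR n a * pairR n b < 0 ->
  (0 < cross_time n a b < 1) /\ pairR n (seg a b (cross_time n a b)) = 0.
Proof.
rewrite pairR_seg /cross_time; set x := pairR n a; set y := pairR n b => h.
have nz : x - y != 0 by apply: contraTneq h => /eqP; rewrite subr_eq0 => /eqP->; rewrite -leNgt -expr2 sqr_ge0.
split; last by field.
have [x0|x0|x0] := ltgtP x 0; last by move: h; rewrite x0 mul0r ltxx.
- have y0 : 0 < y by move: h; rewrite (nmulr_rlt0 _ x0).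
  have d0 : x - y < 0 by lra.
  rewrite -mulrNN -invrN divr_gt0 ?oppr_gt0 //= ltr_pdivrMr ?oppr_gt0 //; lra.
- have y0 : y < 0 by move: h; rewrite (pmulr_rlt0 _ x0).
  have d0 : 0 < x - y by lra.
  rewrite divr_gt0 //= ltr_pdivrMr //; lra.
Qed.

Lemma cross_time_unique n a b (t : R) : pairR n (seg a b t) = 0 -> pairR n b != pairR n a ->
  t = cross_time n a b.
Proof.
rewrite pairR_seg /cross_time; set x := pairR n a; set y := pairR n b => h nz.
have nz' : x - y != 0 by rewrite subr_eq0 eq_sym.
by apply: (mulIf nz'); rewrite divfK //; lra.
Qed.

Lemma crossed_of_time n a b (t : R) : 0 < t < 1 -> pairR n (seg a b t) = 0 ->
  pairR n b != pairR n a -> pairR n a * pairR n b < 0.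
Proof.
rewrite pairR_seg; set x := pairR n a; set y := pairR n b => /andP[t0 t1] h nz.
have ex : x = t * (x - y) by lra.
have ey : y = - (1 - t) * (x - y) by lra.
have nz' : x - y != 0 by rewrite subr_eq0 eq_sym.
have d2 : 0 < (x - y) ^+ 2 by rewrite exprn_even_gt0.
have -> : x * y = - (t * (1 - t) * (x - y) ^+ 2).
  transitivity ((t * (x - y)) * (- (1 - t) * (x - y))); first by rewrite -ex -ey.
  by ring.
by rewrite oppr_lt0 pmulr_lgt0 // mulr_gt0 // subr_gt0.
Qed.

Lemma exists_side v c e : 0 < e -> v != 0 -> pairR v c = 0 ->
  exists2 x, (forall i, `|x i - c i| < e) & 0 < pairR v x.
Proof.
move=> e0 /neq0_coord[k vk] hc.
pose x : pt R r := fun i => c i + (i == k)%:R * ((e / 2) * Num.sg (v k)%:~R).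
have vk' : (v k)%:~R != 0 :> R by rewrite intr_eq0.
exists x => [i|].
  rewrite /x addrAC subrr add0r; case: eqP => _; rewrite ?mul0r ?normr0 //.
  rewrite mul1r normrM normr_sg vk' mulr1 gtr0_norm ?divr_gt0 //.
  by rewrite ltr_pdivrMr // ltr_pMr // ltr1n.
have -> : pairR v x = pairR v c + (v k)%:~R * ((e / 2) * Num.sg (v k)%:~R).
  rewrite /pairR /x; under eq_bigr do rewrite mulrDr; rewrite big_split /=; congr (_ + _).
  by rewrite (bigD1 k) //= eqxx mul1r big1 ?addr0 // => i /negbTE->; rewrite mul0r mulr0.
by rewrite hc add0r mulrCA [_ * Num.sg _]mulrC -normrEsg mulr_gt0 ?divr_gt0 ?normr_gt0.
Qed.

Lemma exists_genpt (S : seq (lat r)) : exists a : pt R r, genpt S a.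
Proof.
have [j|x _ hx] := @exists_avoiding R r _ [seq n <- S | n != 0] (fun n i => (n i)%:~R) (fun=> 0) 1 ltr01.
  by rewrite mem_filter => /andP[/neq0_coord[i ni] _]; exists i; rewrite intr_eq0.
by exists x => n nS n0; apply: hx; rewrite mem_filter n0.
Qed.

(** Genericity against two points allows the last vertex of a loop to be joined both to its
    predecessor and to the first vertex. The value [false] of [s] stands for the positive side. *)
Lemma exists_generic_side (S : seq (lat r)) v c e a b (s : bool) :
  0 < e -> v != 0 -> pairR v c = 0 -> genpt S a -> genpt S b ->
  exists x, [/\ (forall i, `|x i - c i| < e),
    Num.sg (pairR v x) = (-1) ^+ s, genpt S x, genpair S a x & genpair S b x].
Proof.
move=> e0 v0 hc ga gb.
have [x xc xv] : exists2 x, (forall i, `|x i - c i| < e) & Num.sg (pairR v x) = (-1) ^+ s.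
  have [x xc xv] := exists_side e0 v0 hc; case: s; last by exists x; rewrite ?gtr0_sg.
  (* Reflection through [c], a point of v^perp, exchanges the two sides. *)
  exists (fun i => 2 * c i - x i) => [i|].
    have -> : 2 * c i - x i - c i = - (x i - c i) by ring.
    by rewrite normrN.
  rewrite (_ : pairR v _ = - pairR v x) ?sgrN ?gtr0_sg //.
  transitivity (2 * pairR v c - pairR v x); last by rewrite hc mulr0 sub0r.
  by rewrite /pairR mulr_sumr -sumrB; apply: eq_bigr => i _; ring.
have : near x (fun y => Num.sg (pairR v y) = (-1) ^+ s).
  case: s xv => xv.
    have : lin (fun i => (v i)%:~R) x < 0 by rewrite -linE -sgr_lt0 xv expr1 ltrN10.
    by move/near_lin_lt0; apply: near_sub => y; rewrite -linE => /ltr0_sg.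
  have : 0 < lin (fun i => (v i)%:~R) x by rewrite -linE -sgr_gt0 xv expr0.
  by move/near_lin_gt0; apply: near_sub => y; rewrite -linE => /gtr0_sg.
move=> /(near_and (near_near e0 xc))[e' [e'0 h]].
have [z [zx gz gaz gbz]] := exists_generic x e'0 ga gb.
by have [zc zv] := h z zx; exists z.
Qed.

End CrossTime.

(** * Integrality of wall crossings *)

Section Integrality.
Context (R : realType) (r : nat) (F : {set 'I_r}) (om : 'I_r -> 'I_r -> rat).
Context (D : diagram r).
Hypothesis om_skew : forall i j, om i j = - om j i.
Hypothesis hD : scat_ok R F D.
Implicit Types (a b c x y : pt R r) (v w n : lat r) (i j k : nat).

Local Notation W := (dw D).
Local Notation cone := (cone F).
Local Notation deg := (deg F).
Local Notation act := (act F D).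
Local Notation omega := (omega om).

(** Avoidance of [Sing] restricted to the walls active at level [k], a condition that weakens as [k]
    decreases. *)
Definition nonsing k y :=
  (forall i, act k i -> in_supp (W i) y -> relint (W i) y) /\
  (forall i j, act k i -> act k j -> in_supp (W i) y -> in_supp (W j) y ->
     parallel (wn (W i)) (wn (W j))).

Definition walls_at k y := [seq i <- iota 0 (dbnd D k) | act k i && in_supp (W i) y].

Lemma mem_walls_at k y i : (i \in walls_at k y) = act k i && in_supp (W i) y.
Proof.
by rewrite mem_filter mem_iota /= add0n andb_idr // => /andP[/(act_lt hD)].
Qed.

Lemma filter_iota_bound (P : pred nat) B C : (forall i, P i -> (i < B)%N) -> (B <= C)%N ->
  filter P (iota 0 C) = filter P (iota 0 B).
Proof.
move=> hP BC; rewrite -(subnKC BC) iotaD filter_cat add0n.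
rewrite [X in _ ++ X](@eq_in_filter _ _ pred0) ?filter_pred0 ?cats0 // => i.
rewrite mem_iota => /andP[Bi _]; apply/negbTE/negP => /hP; lia.
Qed.

Lemma walls_at_level k l y : (l <= k)%N -> filter (act l) (walls_at k y) = walls_at l y.
Proof.
move=> lk; rewrite /walls_at -filter_predI.
set P := predI _ _.
have hP i : P i = act l i && in_supp (W i) y.
  by rewrite /P /=; case al: (act l i); rewrite //= (act_mono lk al).
have h1 i : P i -> (i < dbnd D k)%N.
  by rewrite hP => /andP[/(act_mono lk) /(act_lt hD)].
have h2 i : P i -> (i < dbnd D l)%N by rewrite hP => /andP[/(act_lt hD)].
transitivity (filter P (iota 0 (maxn (dbnd D k) (dbnd D l)))).
  by rewrite (filter_iota_bound h1) // leq_maxl.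
by rewrite (filter_iota_bound h2) ?leq_maxr //; apply: eq_filter.
Qed.

Lemma wprod_walls_at (e : nat -> rat) k l y v : (l <= k)%N -> deg v <= l%:Z ->
  pcoef (wprod D e k (walls_at k y)) v = pcoef (wprod D e l (walls_at l y)) v.
Proof.
move=> lk hv; rewrite (wprod_filter hD _ _ lk hv) (walls_at_level _ lk).
by apply: (wprod_level hD) => //; apply: le_trans hv _; rewrite lez_nat.
Qed.

(** The exponents are signed, so a crossing in the opposite direction is the case of [- n]. *)
Definition bend_coef k y n v : rat :=
  pcoef (wprod D (fun i => omega n (wn (W i))) k (walls_at k y)) v.

Lemma nonsing_level k l y : (l <= k)%N -> nonsing k y -> nonsing l y.
Proof.
move=> lk [h1 h2]; split=> [i /(act_mono lk)|i j /(act_mono lk) ai /(act_mono lk)]; first exact: h1.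
exact: h2.
Qed.

Lemma wprod_supp_parallel (e : nat -> rat) k (L : seq nat) w v :
  {in L, forall i, parallel (wn (W i)) w} -> pcoef (wprod D e k L) v != 0 -> parallel v w.
Proof.
move=> hL /pcoef_neq0[x xL <-].
elim: L x hL xL => [|i L IH] x hL.
  by rewrite inE => /eqP->; exact: parallel0.
move=> /allpairsP[[x1 x2] /= [/mapP[j _ ->] x2L ->]] /=.
apply: parallelD; first by apply: parallelMn; apply: hL; rewrite mem_head.
by apply: IH x2L => l lL; apply: hL; rewrite in_cons lL orbT.
Qed.

Lemma bend_coef_nil k y n v : v != 0 -> walls_at k y = [::] -> bend_coef k y n v = 0.
Proof. by move=> v0 h; rewrite /bend_coef h pcoef_one (negbTE v0). Qed.

(** At a nonsingular point every factor is a series in multiples of one direction, and so is the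
    product. *)
Lemma bend_coef_parallel k y n v i : nonsing k y -> i \in walls_at k y ->
  bend_coef k y n v != 0 -> parallel v (wn (W i)).
Proof.
move=> [_ hy] hi; apply: wprod_supp_parallel => j; rewrite !mem_walls_at in hi *.
by move: hi => /andP[ai si] /andP[aj sj]; exact: hy.
Qed.

Lemma wn_parallel_sgr i j x : parallel (wn (W i)) (wn (W j)) ->
  Num.sg (pairR (wn (W i)) x) = Num.sg (pairR (wn (W j)) x).
Proof.
have /coneP[ci _] := wn_cone hD i; have /coneP[cj _] := wn_cone hD j.
exact: (parallel_sgr _ ci cj (wn_neq0 hD i) (wn_neq0 hD j)).
Qed.

Definition seg_walls k a b :=
  sort (fun i j => cross_time (wn (W i)) a b <= cross_time (wn (W j)) a b)
    [seq i <- iota 0 (dbnd D k) | active F D k i && crossedb D a b i].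

Definition side a i : rat := if 0 < pairR (wn (W i)) a then 1 else -1.

Definition seg_ops k a b := [seq (side a i, i) | i <- seg_walls k a b].

Lemma seg_crossE k a b q : seg_cross F om D k a b q = crosses om D k (seg_ops k a b) q.
Proof.
rewrite /seg_cross /seg_ops -/(seg_walls k a b) /crosses.
elim: (seg_walls k a b) q => //= i L IH q; exact: IH.
Qed.

Lemma gen_seg_nonsing k a b (t : R) : gen_seg F D k a b -> 0 <= t <= 1 -> nonsing k (seg a b t).
Proof.
move=> [_ h2 h3 _] ht; split=> [i ai|i j ai aj si sj].
  by apply: h2; rewrite ?(activeE hD).
by apply: contrapT => np; apply: (h3 i j _ _ np _ ht); rewrite ?(activeE hD).
Qed.

(** The lists agree even in order: filtering commutes with the sort, and equal crossing times leave
    the index order unchanged. *)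
Lemma seg_walls_at k a b (t : R) : gen_seg F D k a b -> 0 < t < 1 ->
  [seq i <- seg_walls k a b | cross_time (wn (W i)) a b == t] = walls_at k (seg a b t).
Proof.
move=> g ht; have ht' : 0 <= t <= 1 by case/andP: ht => /ltW-> /ltW->.
have tot : total (fun i j => cross_time (wn (W i)) a b <= cross_time (wn (W j)) a b).
  by move=> i j; exact: le_total.
have tr : transitive (fun i j => cross_time (wn (W i)) a b <= cross_time (wn (W j)) a b).
  by move=> i j l; exact: le_trans.
rewrite filter_sort //.
have -> : [seq i <- [seq i <- iota 0 (dbnd D k) | active F D k i && crossedb D a b i]
            | cross_time (wn (W i)) a b == t] = walls_at k (seg a b t).
  rewrite -filter_predI; apply: eq_filter => i /=; rewrite (activeE hD).
  case ai: (act k i); rewrite ?andbF //=; apply/idP/idP.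
    by move=> /andP[/eqP e /andP[_]]; rewrite e.
  move=> si; have [_ _ _ g4] := g.
  have nz : pairR (wn (W i)) b != pairR (wn (W i)) a.
    by apply: g4; rewrite ?(activeE hD) //; exists t.
  have z : pairR (wn (W i)) (seg a b t) = 0 by case/andP: si => /eqP.
  by rewrite -(cross_time_unique z nz) eqxx /crossedb (crossed_of_time ht z nz) -(cross_time_unique z nz).
apply: (sorted_sort tr); apply: (@sorted_const_key _ _ t) => i.
rewrite mem_walls_at => /andP[ai si]; have [_ _ _ g4] := g.
apply/esym/cross_time_unique; first by case/andP: si => /eqP.
by apply: g4; rewrite ?(activeE hD) //; exists t.
Qed.

Lemma side_const k y a i j : nonsing k y -> i \in walls_at k y -> j \in walls_at k y ->
  side a i = side a j.
Proof.
move=> [_ hy]; rewrite !mem_walls_at => /andP[ai si] /andP[aj sj].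
rewrite /side -(sgr_gt0 (pairR (wn (W i)) a)) -(sgr_gt0 (pairR (wn (W j)) a)).
by rewrite (wn_parallel_sgr _ (hy _ _ ai aj si sj)).
Qed.

Lemma side_omega (s : rat) n : s = 1 \/ s = -1 ->
  exists n' : lat r, forall w, s * omega n w = omega n' w.
Proof.
move=> [->|->]; first by exists n => u; rewrite mul1r.
by exists (- n) => u; rewrite omegaNl mulN1r.
Qed.

Lemma sideP a i : side a i = 1 \/ side a i = -1.
Proof. by rewrite /side; case: ifP; [left|right]. Qed.

(** Parallel walls are crossed from a common side, so one sign can be moved into the exponent: the
    witness is [n] or [- n]. *)
Lemma ker_walls_at k y a n w : nonsing k y ->
  exists n', ker om D k [seq (side a i, i) | i <- walls_at k y] n w = bend_coef k y n' w.
Proof.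
move=> hy.
have par : {in walls_at k y &, forall i j, omega (wn (W i)) (wn (W j)) = 0}.
  move=> i j; rewrite !mem_walls_at => /andP[ai si] /andP[aj sj].
  by apply: (omega_parallel om_skew); apply: (proj2 hy).
case E: (walls_at k y) => [|i0 L].
  by exists n; rewrite /bend_coef E /ker /= pcoef_mon pcoef_one -[n == _]subr_eq0 opprD addrA subrr add0r oppr_eq0; case: eqP.
rewrite -E; have i0L : i0 \in walls_at k y by rewrite E mem_head.
have [n' hn'] := side_omega n (sideP a i0).
exists n'; rewrite (ker_parallel _ _ _ _ par) /bend_coef /wprod; congr (pcoef (foldr _ _ _) _).
apply/eq_in_map => i iL; congr ptpow.
by rewrite (side_const a hy iL i0L) hn'.
Qed.

Definition bend_int l := forall y, nonsing l y ->
  forall n v, deg v = l%:Z -> bend_coef l y n v \is a Num.int.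

Lemma bend_coef_int_lt k y n w : (forall l, (l < k)%N -> bend_int l) -> nonsing k y ->
  deg w < k%:Z -> bend_coef k y n w \is a Num.int.
Proof.
move=> IH hy hw; have [/eqP->|nz] := boolP (bend_coef k y n w == 0); first exact: rpred0.
have cw := pcoef_cone (in_cone_wprod hD _ _ _) nz.
have [l hl] : exists l : nat, deg w = l%:Z.
  by have := deg_ge0 cw; case: (deg w) => // l _; exists l.
have lk : (l < k)%N by rewrite -ltz_nat -hl.
rewrite /bend_coef (wprod_walls_at _ _ (ltnW lk)) ?hl //.
by apply: (IH _ lk) => //; exact: nonsing_level (ltnW lk) hy.
Qed.

(** The crossings are grouped by time. Each group is the full set of walls through one point of the
    segment, where [bend_coef] describes it. *)
Lemma seg_int_upto k a b v : gen_seg F D k a b -> deg v = k%:Z ->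
  (forall l, (l < k)%N -> bend_int l) ->
  (forall t : R, 0 < t < 1 -> forall n, bend_coef k (seg a b t) n v \is a Num.int) ->
  int_upto F om D k v (seg_ops k a b).
Proof.
move=> g dv IH hv; rewrite /seg_ops.
apply: (@sorted_key_ind R (fun i => cross_time (wn (W i)) a b)
  (fun L => int_upto F om D k v [seq (side a i, i) | i <- L])).
- exact: int_upto_nil.
- by move=> L1 L2 h1 h2; rewrite map_cat; exact: (int_upto_cat hD).
- by apply: sort_sorted => i j; exact: le_total.
move=> t; case E: [seq i <- seg_walls k a b | cross_time (wn (W i)) a b == t] => [|i0 L].
  exact: int_upto_nil.
have ht : 0 < t < 1.
  have : i0 \in [seq i <- seg_walls k a b | cross_time (wn (W i)) a b == t] by rewrite E mem_head.
  rewrite mem_filter mem_sort mem_filter => /andP[/eqP<- /andP[/andP[_ /andP[h _]] _]].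
  by case: (cross_timeP h).
have hy : nonsing k (seg a b t).
  by apply: (gen_seg_nonsing g); case/andP: ht => /ltW-> /ltW->.
rewrite -E (seg_walls_at g ht) => n w hw.
have [n' ->] := ker_walls_at a n w hy.
by case: hw => [hw|->]; [exact: bend_coef_int_lt|exact: hv].
Qed.

End Integrality.

(** * The loop through v^perp near a given point and near pi_1(v) *)

Section IntegralityMain.
Context (R : realType) (r : nat) (F : {set 'I_r}) (om : 'I_r -> 'I_r -> rat) (d : 'I_r -> rat).
Context (D : diagram r).
Hypothesis om_skew : forall i j, om i j = - om j i.
Hypothesis dom_int : forall i j, exists z : int, d i * om i j = z%:~R.
Hypothesis hD : scat_ok R F D.
Hypothesis hcons : consistent R F om D.
Context (ix : 'I_r -> nat).
Hypothesis ix_init : forall i, i \notin F -> wall_equiv R (dw D (ix i)) (init_wall d i).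
Hypothesis out : forall j : nat, (forall i, i \notin F -> j <> ix i) -> nontriv (dw D j) ->
  outgoing R om (dw D j).
Implicit Types (a b c x y : pt R r) (v w n : lat r) (i j k : nat).

Local Notation W := (dw D).
Local Notation cone := (cone F).
Local Notation deg := (deg F).
Local Notation act := (act F D).
Local Notation omega := (omega om).

(** By skew-symmetry this is minus the pairing of [n] with d_i pi_1(f_i), an element of the dual
    lattice. *)
Lemma omega_fvec_int n (i : 'I_r) : omega n (fvec i) * d i \is a Num.int.
Proof.
rewrite omega_pi1Q mulr_suml; apply: rpred_sum => j _.
rewrite ffunE; case: eqP => [->|_]; last by rewrite mul0r mul0r rpred0.
rewrite mul1r /pi1Q mulr_suml; apply: rpred_sum => l _.
have [z hz] := dom_int i l.
by rewrite -mulrA om_skew mulNr (mulrC (om i l)) hz -intrN -intrM intr_int.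
Qed.

Lemma init_wall_int (i : 'I_r) (l : nat) (e : nat -> rat) k v :
  wall_equiv R (W l) (init_wall d i) -> e l * d i \is a Num.int -> deg v <= k%:Z ->
  pcoef (wprod D e k [:: l]) v \is a Num.int.
Proof.
move=> [hwn _ hwg] he hv; rewrite /wprod /= pcoef_pmulC pcoef_pmul1.
case: (pselect (exists j, v = wn (W l) *+ j)) => [[j vj]|h]; last first.
  by rewrite pcoef_ptpow_not ?rpred0 // => j ej; apply: h; exists j.
have -> : pcoef (ptpow (e l) (W l) k) v = binomQ (e l * d i) j.
  rewrite (pcoef_ptpow hD _ vj hv) -gpow_binomQ; congr gpow.
  by apply/funext => m; rewrite hwg.
exact: binomQ_int.
Qed.

Lemma fvec_parallel_inj (i j : 'I_r) : parallel (fvec i) (fvec j) -> i = j.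
Proof.
move=> /(_ i j); rewrite !ffunE !eqxx; case: (i =P j) => // _; by rewrite mulr0 mulr1.
Qed.

Lemma pairR_pi1 n v : pairR n (pi1 R om v) = ratr (omega v n).
Proof.
rewrite omega_pi1Q rmorph_sum; apply: eq_bigr => i _ /=.
by rewrite rmorphM /= ratr_int.
Qed.

Lemma in_supp_scale (w : wall r) x y (s : R) : 0 < s -> (forall l : 'I_r, y l = s * x l) ->
  in_supp w y = in_supp w x.
Proof.
move=> s0 h; have e u : pairR u y = s * pairR u x.
  by rewrite /pairR mulr_sumr; apply: eq_bigr => i _; rewrite h; ring.
rewrite /in_supp e mulf_eq0 (gt_eqF s0) /=; congr andb.
by apply: eq_all => u; rewrite e pmulr_rge0.
Qed.

(** [outgoing] speaks of pi_1 of the normal itself; pi_1(v) is a positive multiple of it, and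
    supports are cones. *)
Lemma outgoing_pi1_parallel i v : cone v -> v != 0 -> parallel (wn (W i)) v ->
  outgoing R om (W i) -> ~~ in_supp (W i) (pi1 R om v).
Proof.
move=> /coneP[cv _] v0 par; apply: contra => h.
have /coneP[cw _] := wn_cone hD i.
have [p [q [p0 q0 e]]] := parallel_scale cw cv (wn_neq0 hD i) v0 par.
rewrite (@in_supp_scale _ (pi1 R om v) _ (q%:~R / p%:~R)) ?divr_gt0 ?ltr0z // => j.
have pn : p%:~R != 0 :> R by rewrite intr_eq0 gt_eqF.
have -> : q%:~R / p%:~R * pi1 R om v j = p%:~R^-1 * (q%:~R * pi1 R om v j) by ring.
apply: (mulfI pn); rewrite [RHS]mulrA divff // mul1r /pi1.
rewrite -(ratr_int R p) -(ratr_int R q) -!rmorphM /=; congr ratr.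
rewrite /pi1Q !mulr_sumr; apply: eq_bigr => l _.
by rewrite !mulrA -!intrM mulrC (mulrC p) e (mulrC q) mulrC.
Qed.

(** The inequalities are included so that generic segments also avoid the boundaries of walls. *)
Definition normals k : seq (lat r) :=
  flatten [seq wn (W i) :: wineq (W i) | i <- iota 0 (dbnd D k)].

Lemma wn_normals k i : act k i -> wn (W i) \in normals k.
Proof.
move=> /(act_lt hD) hi; apply/flattenP; exists (wn (W i) :: wineq (W i)); last exact: mem_head.
by apply: (map_f (fun i => wn (W i) :: wineq (W i))); rewrite mem_iota.
Qed.

Lemma wineq_normals k i u : act k i -> u \in wineq (W i) -> u \in normals k.
Proof.
move=> /(act_lt hD) hi hu; apply/flattenP; exists (wn (W i) :: wineq (W i)).
  by apply: (map_f (fun i => wn (W i) :: wineq (W i))); rewrite mem_iota.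
by rewrite in_cons hu orbT.
Qed.

Lemma generic_gen_seg k a b : genpt (normals k) a -> genpt (normals k) b ->
  genpair (normals k) a b -> gen_seg F D k a b.
Proof.
move=> ga gb gab.
have nosupp x i : act k i -> genpt (normals k) x -> ~~ in_supp (W i) x.
  move=> ai gx; apply: contra (gx _ (wn_normals ai) (wn_neq0 hD i)) => /andP[/eqP-> _].
  by rewrite eqxx.
split=> i.
- rewrite (activeE hD) => ai; by split; apply: nosupp.
- rewrite (activeE hD) => ai t _ si; apply: relint_of_generic => // [|u uw np]; first exact: (wn_neq0 hD).
  apply/negP => /eqP hu; apply: (genpair_seg gab (wn_normals ai) (wineq_normals ai uw) np _ hu).
  by case/andP: si => /eqP.
- move=> j; rewrite !(activeE hD) => ai aj np t _ [/andP[/eqP si _] /andP[/eqP sj _]].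
  exact: (genpair_seg gab (wn_normals ai) (wn_normals aj) np si sj).
- rewrite (activeE hD) => ai [t [_ /andP[/eqP + _]]]; rewrite pairR_seg => h.
  apply: contra (ga _ (wn_normals ai) (wn_neq0 hD i)) => /eqP e.
  by move: h; rewrite e subrr mulr0 addr0 => ->.
Qed.

(** Inside the ball the walls through [y] fill v^perp and no other active wall enters. A segment
    from the positive to the negative side thus crosses exactly these walls, all at one instant. *)
Lemma seg_walls_crossing k y v a b (e : R) i0 : nonsing F D k y -> cone v -> v != 0 ->
  i0 \in walls_at F D k y -> parallel v (wn (W i0)) ->
  (forall x, (forall l : 'I_r, `|x l - y l| < e) -> forall i, act k i ->
     (in_supp (W i) y -> pairR (wn (W i)) x = 0 -> in_supp (W i) x) /\
     (in_supp (W i) x -> in_supp (W i) y)) ->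
  (forall l : 'I_r, `|a l - y l| < e) -> (forall l : 'I_r, `|b l - y l| < e) ->
  Num.sg (pairR v a) = 1 -> Num.sg (pairR v b) = -1 -> gen_seg F D k a b ->
  seg_walls F D k a b = walls_at F D k y /\ {in walls_at F D k y, forall i, side D a i = 1}.
Proof.
move=> hy cv v0; rewrite mem_walls_at // => /andP[a0 s0] par hball ha hb sa sb g.
have /coneP[cv' _] := cv.
have hW i : in_supp (W i) y -> act k i -> forall x,
    Num.sg (pairR (wn (W i)) x) = Num.sg (pairR v x).
  move=> si ai x; have /coneP[cw _] := wn_cone hD i; apply/esym.
  apply: (parallel_sgr _ cv' cw v0 (wn_neq0 hD i)).
  apply: (parallel_trans (wn_neq0 hD i0) par); exact: (proj2 hy).
have supp_between i (t : R) : act k i -> 0 <= t <= 1 ->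
    (in_supp (W i) y -> pairR (wn (W i)) (seg a b t) = 0 -> in_supp (W i) (seg a b t)) /\
    (in_supp (W i) (seg a b t) -> in_supp (W i) y).
  by move=> ai ht; apply: hball => //; exact: seg_ball.
have wlt i : act k i -> in_supp (W i) y -> pairR (wn (W i)) a * pairR (wn (W i)) b < 0.
  by move=> ai si; rewrite -sgr_lt0 sgrM !hW // sa sb mul1r ltrN10.
have E : [seq i <- iota 0 (dbnd D k) | active F D k i && crossedb D a b i] = walls_at F D k y.
  apply: eq_filter => i; rewrite (activeE hD).
  case ai: (act k i) => //=; apply/idP/idP.
    move=> /andP[h]; have [/andP[t0 t1] _] := cross_timeP h.
    have ht : 0 <= cross_time (wn (W i)) a b <= 1 by rewrite (ltW t0) (ltW t1).
    by have [_] := supp_between i _ ai ht.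
  move=> si; have h := wlt i ai si; rewrite /crossedb h /=.
  have [/andP[t0 t1] z] := cross_timeP h.
  have ht : 0 <= cross_time (wn (W i)) a b <= 1 by rewrite (ltW t0) (ltW t1).
  by have [/(_ si z)] := supp_between i _ ai ht.
split; last first.
  by move=> i; rewrite mem_walls_at // => /andP[ai si]; rewrite /side -sgr_gt0 hW // sa ltr01.
rewrite /seg_walls E; apply: sorted_sort; first by move=> i j l; exact: le_trans.
apply: (@sorted_const_key _ _ (cross_time (wn (W i0)) a b)) => i.
rewrite mem_walls_at // => /andP[ai si]; have h0 := wlt i0 a0 s0; have h := wlt i ai si.
have [_ z] := cross_timeP h0; apply/esym/cross_time_unique.
  by apply: (parallel_pairR_eq0 (wn_neq0 hD i0) _ z); exact: (proj2 hy).
by apply: contraTneq h => ->; rewrite -leNgt -expr2 sqr_ge0.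
Qed.

(** The first clause is the relative interior condition, the second the closedness of the finitely
    many active walls missing [y]. *)
Lemma near_walls_at k y : nonsing F D k y ->
  near y (fun x => forall i, act k i ->
     (in_supp (W i) y -> pairR (wn (W i)) x = 0 -> in_supp (W i) x) /\
     (in_supp (W i) x -> in_supp (W i) y)).
Proof.
move=> [hy _].
have H i : i \in iota 0 (dbnd D k) -> near y (fun x => act k i ->
     (in_supp (W i) y -> pairR (wn (W i)) x = 0 -> in_supp (W i) x) /\
     (in_supp (W i) x -> in_supp (W i) y)).
  move=> _; case ai: (act k i); last by apply: nearT.
  case si: (in_supp (W i) y); last first.
    by apply: near_sub (near_not_supp (negbT si)) => x /negbTE h _; rewrite h.
  have [_ [e [e0 he]]] := hy i ai si; exists e; split=> // x hx _; split=> // _ z.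
  exact: he.
apply: near_sub (near_all H) => x h i ai; apply: h => //.
by rewrite mem_iota; exact: (act_lt hD ai).
Qed.

(* An outgoing wall in [v^perp] avoids the ray of [pi1 v], so the walls in
   [v^perp] close to [pi1 v] are initial. *)
Lemma near_pi1_walls k v : cone v -> v != 0 ->
  near (pi1 R om v) (fun x => forall i, act k i -> parallel (wn (W i)) v ->
     in_supp (W i) x -> exists2 i' : 'I_r, i' \notin F & i = ix i').
Proof.
move=> cv v0.
have H i : i \in iota 0 (dbnd D k) -> near (pi1 R om v) (fun x => act k i -> parallel (wn (W i)) v ->
     in_supp (W i) x -> exists2 i' : 'I_r, i' \notin F & i = ix i').
  move=> _; case: (pselect (exists2 i' : 'I_r, i' \notin F & i = ix i')) => [h|h].
    exact: nearT.
  case ai: (act k i); last exact: nearT.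
  case: (pselect (parallel (wn (W i)) v)) => par; last by apply: nearT.
  have o : outgoing R om (W i).
    apply: out; last exact: act_nontriv ai.
    by move=> i' i'F e; apply: h; exists i'.
  by apply: near_sub (near_not_supp (outgoing_pi1_parallel cv v0 par o)) => x /negbTE hx _ _; rewrite hx.
apply: near_sub (near_all H) => x h i ai; apply: h => //.
by rewrite mem_iota; exact: (act_lt hD ai).
Qed.

Lemma bend_coef_pi1_int k y n v : nonsing F D k y -> deg v = k%:Z -> v != 0 ->
  (forall i, act k i -> parallel (wn (W i)) v -> in_supp (W i) y ->
     exists2 i' : 'I_r, i' \notin F & i = ix i') ->
  bend_coef F om D k y n v \is a Num.int.
Proof.
move=> hy dv v0 h.
case E: (walls_at F D k y) => [|i0 L]; first by rewrite bend_coef_nil.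
have i0L : i0 \in walls_at F D k y by rewrite E mem_head.
have [/eqP->|nz] := boolP (bend_coef F om D k y n v == 0); first exact: rpred0.
have hpar i : i \in walls_at F D k y -> parallel (wn (W i)) v.
  by move=> iL; apply: parallel_sym; exact: (bend_coef_parallel hD hy iL nz).
have hinit' i : i \in walls_at F D k y ->
    exists2 i' : 'I_r, i' \notin F & i = ix i'.
  by move=> iL; move: (iL); rewrite mem_walls_at // => /andP[ai si]; apply: h => //; exact: hpar.
(* Distinct basis vectors are not parallel, so only one initial wall can have its normal parallel to
   [v]. *)
have hL : {in walls_at F D k y, forall i, i = i0}.
  move=> i iL; have [i1 i1F e1] := hinit' i iL; have [i2 i2F e2] := hinit' i0 i0L.
  rewrite e1 e2; congr ix; apply: fvec_parallel_inj.
  have [/= w1 _ _] := ix_init i1F; have [/= w2 _ _] := ix_init i2F.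
  rewrite -w1 -w2 -e1 -e2.
  exact: (parallel_trans v0 (hpar _ iL) (parallel_sym (hpar _ i0L))).
have E1 : walls_at F D k y = [:: i0].
  have uL : uniq (walls_at F D k y) by rewrite filter_uniq ?iota_uniq.
  rewrite E in hL uL *; case: L {E} hL uL => // i1 L hL /=.
  by rewrite (hL i1) ?mem_head ?in_cons ?eqxx ?orbT.
have [i' i'F e] := hinit' i0 i0L; have we := ix_init i'F; rewrite -e in we.
rewrite /bend_coef E1; apply: (init_wall_int we); rewrite ?dv //.
by have [-> _ _] := we; exact: omega_fvec_int.
Qed.

(** A nonzero coefficient at [v] would need a wall through [y] with normal parallel to [v], putting
    [y] on v^perp. *)
Lemma bend_coef_far_int k y n v : nonsing F D k y -> v != 0 -> pairR v y != 0 ->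
  bend_coef F om D k y n v \is a Num.int.
Proof.
move=> hy v0 hv; case E: (walls_at F D k y) => [|i0 L]; first by rewrite bend_coef_nil.
have i0L : i0 \in walls_at F D k y by rewrite E mem_head.
have [/eqP->|nz] := boolP (bend_coef F om D k y n v == 0); first exact: rpred0.
have par := parallel_sym (bend_coef_parallel hD hy i0L nz).
move: i0L; rewrite mem_walls_at // => /andP[_ /andP[/eqP z _]].
by move: hv; rewrite (parallel_pairR_eq0 (wn_neq0 hD i0) par z) eqxx.
Qed.

Lemma seg_side_sgr v a b (s t : R) : Num.sg (pairR v a) = s -> Num.sg (pairR v b) = s ->
  s != 0 -> 0 < t < 1 -> pairR v (seg a b t) != 0.
Proof.
rewrite pairR_seg => sa sb s0 /andP[t0 t1].
have [h|h|h] := ltgtP (pairR v a) 0; last by move: s0; rewrite -sa h sgr0 eqxx.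
  have hb : pairR v b < 0 by rewrite -sgr_lt0 sb -sa sgr_lt0.
  by apply: ltr0_neq0; nra.
have hb : 0 < pairR v b by rewrite -sgr_gt0 sb -sa sgr_gt0.
by apply: lt0r_neq0; nra.
Qed.

Lemma bend_int_all k : bend_int R F om D k.
Proof.
elim/ltn_ind: k => k IH y hy n v dv.
have [/eqP->|nz] := boolP (bend_coef F om D k y n v == 0); first exact: rpred0.
have cv := pcoef_cone (in_cone_wprod hD _ _ _) nz.
have [v0|v0] := eqVneq v 0.
  by rewrite v0 /bend_coef (pcoef_wprod0 hD).
case E: (walls_at F D k y) => [|i0 L]; first by rewrite bend_coef_nil.
have i0L : i0 \in walls_at F D k y by rewrite E mem_head.
have par := bend_coef_parallel hD hy i0L nz.
have hvy : pairR v y = 0.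
  move: (i0L); rewrite mem_walls_at // => /andP[_ /andP[/eqP z _]].
  exact: (parallel_pairR_eq0 (wn_neq0 hD i0) (parallel_sym par) z).
have hvq : pairR v (pi1 R om v) = 0.
  by rewrite pairR_pi1 (omega_parallel om_skew (parallel_refl v)) rmorph0.
have [e1 [e10 h1]] := near_walls_at hy.
have [e2 [e20 h2]] := near_pi1_walls k cv v0.
(* [g0] only seeds the choice of [A], as [exists_generic_side] takes generic points as input. *)
have [g0 gg0] := @exists_genpt R r (normals k).
(* The loop [A -> B -> B' -> A' -> A] crosses [v^perp] twice: near [y] along
   [A -> B], and near [pi1 v] along [B' -> A'], where the crossing is integral. *)
have [A [Ac Av gA _ _]] := exists_generic_side false e10 v0 hvy gg0 gg0.
have [B [Bc Bv gB gAB _]] := exists_generic_side true e10 v0 hvy gA gA.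
have [B' [Bc' Bv' gB' gBB' _]] := exists_generic_side true e20 v0 hvq gB gB.
have [A' [Ac' Av' gA' gBA' gAA']] := exists_generic_side false e20 v0 hvq gB' gA.
rewrite expr0 expr1 in Av Bv Av' Bv'.
have s1 := generic_gen_seg gA gB gAB.
have s2 := generic_gen_seg gB gB' gBB'.
have s3 := generic_gen_seg gB' gA' gBA'.
have s4 := generic_gen_seg gA' gA (genpair_sym gAA').
have [w1 side1] := seg_walls_crossing hy cv v0 i0L par h1 Ac Bc Av Bv s1.
have in01 (t : R) : 0 < t < 1 -> 0 <= t <= 1 by move=> /andP[/ltW-> /ltW->].
have n1 : ker om D k (seg_ops F D k A B) n v = bend_coef F om D k y n v.
  rewrite /seg_ops w1 ker_parallel => [|i j].
    rewrite /bend_coef /wprod; congr (pcoef (foldr _ _ _) _); apply/eq_in_map => i iL.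
    by rewrite side1 // mul1r.
  rewrite !mem_walls_at // => /andP[ai si] /andP[aj sj].
  by apply: (omega_parallel om_skew); exact: (proj2 hy).
(* Only degrees below [k]: the coefficient at [v] is the unknown. *)
have u1 n' w : deg w < k%:Z -> ker om D k (seg_ops F D k A B) n' w \is a Num.int.
  move=> hw; rewrite /seg_ops w1.
  have [n'' ->] := ker_walls_at om_skew hD A n' w hy.
  exact: bend_coef_int_lt.
(* Both endpoints lie on the negative side, so the segment never meets v^perp. *)
have u2 : int_upto F om D k v (seg_ops F D k B B').
  apply: (seg_int_upto om_skew hD s2 dv IH) => t ht m; apply: bend_coef_far_int => //.
    exact: gen_seg_nonsing s2 (in01 _ ht).
  by apply: (seg_side_sgr Bv Bv') => //; rewrite oppr_eq0 oner_eq0.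
have u3 : int_upto F om D k v (seg_ops F D k B' A').
  apply: (seg_int_upto om_skew hD s3 dv IH) => t ht m; apply: bend_coef_pi1_int => //.
    exact: gen_seg_nonsing s3 (in01 _ ht).
  by apply: h2; apply: seg_ball => //; exact: in01.
have u4 : int_upto F om D k v (seg_ops F D k A' A).
  apply: (seg_int_upto om_skew hD s4 dv IH) => t ht m; apply: bend_coef_far_int => //.
    exact: gen_seg_nonsing s4 (in01 _ ht).
  by apply: (seg_side_sgr Av' Av) => //; rewrite oner_eq0.
pose L' := seg_ops F D k B B' ++ (seg_ops F D k B' A' ++ seg_ops F D k A' A).
have u' : int_upto F om D k v L' by do 2! [apply: (int_upto_cat hD) => //].
have loop : ker om D k (seg_ops F D k A B ++ L') n v = 0.
  have := hcons (k := k) (pts := [:: A; B; B'; A'; A]) isT erefl.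
  move=> /(_ _ n (n + v)); rewrite /path_prod /= !seg_crossE => h.
  rewrite /ker !crosses_cat h.
  - by rewrite -subr_eq0 addrAC subrr add0r (negbTE v0).
  - by case=> [|[|[|[|//]]]].
  - by rewrite degD dv.
(* The loop has coefficient 0 at [v], so the unknown and the coefficient of the rest [L'] add up to
   an integer. *)
have := @ker_cat_mod R r F om D hD k (seg_ops F D k A B) L' n v v0.
rewrite loop dv => /(_ u1) /(_ (fun n' w hw => u' n' w (or_introl hw))).
rewrite sub0r rpredN n1 => h.
rewrite -(addrK (ker om D k L' n v) (bend_coef _ _ _ _ _ _ _)) rpredB //.
by apply: u'; right.
Qed.

End IntegralityMain.

(** * Frobenius congruences *)

Section Congruence.
Context (p : nat).
Hypothesis p_gt0 : (0 < p)%N.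
Implicit Types x y : rat.

(** Congruence modulo the subgroup pZ of the rationals. It is an ideal only over the integers, hence
    the integrality hypotheses of [congM]. *)
Definition cong x y : Prop := (x - y) / p%:R \is a Num.int.

Lemma cong_refl x : cong x x.
Proof. by rewrite /cong subrr mul0r rpred0. Qed.

Lemma cong_sym x y : cong x y -> cong y x.
Proof. by rewrite /cong -(rpredN _ (_ / _)) -mulNr opprB. Qed.

Lemma cong_trans y x z : cong x y -> cong y z -> cong x z.
Proof.
rewrite /cong => h1 h2.
have -> : (x - z) / p%:R = (x - y) / p%:R + (y - z) / p%:R by ring.
exact: rpredD.
Qed.

Lemma congD x y x' y' : cong x y -> cong x' y' -> cong (x + x') (y + y').
Proof.
rewrite /cong => h1 h2.
have -> : (x + x' - (y + y')) / p%:R = (x - y) / p%:R + (x' - y') / p%:R by ring.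
exact: rpredD.
Qed.

Lemma cong_sum (I : Type) (s : seq I) (P : pred I) (f g : I -> rat) :
  (forall i, P i -> cong (f i) (g i)) ->
  cong (\sum_(i <- s | P i) f i) (\sum_(i <- s | P i) g i).
Proof. by move=> h; apply: big_ind2 => //; [exact: cong_refl|move=> *; exact: congD]. Qed.

Lemma congM x y x' y' : x' \is a Num.int -> y \is a Num.int ->
  cong x y -> cong x' y' -> cong (x * x') (y * y').
Proof.
rewrite /cong => ix' iy h1 h2.
have -> : (x * x' - y * y') / p%:R = (x - y) / p%:R * x' + y * ((x' - y') / p%:R) by ring.
by rewrite rpredD // rpredM.
Qed.

Lemma cong_mulp x : x \is a Num.int -> cong (x *+ p) 0.
Proof.
move=> ix; rewrite /cong subr0 -[x *+ p]mulr_natr mulfK //.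
by rewrite pnatr_eq0 -lt0n.
Qed.

End Congruence.

Lemma rcons_cons_const (T : eqType) (x : T) (s : seq T) :
  rcons s x = x :: s -> s = nseq (size s) x.
Proof. by elim: s => //= y s IH [-> /IH <-]. Qed.

Lemma rot1_const (T : eqType) (x0 : T) (s : seq T) :
  rot 1 s = s -> s = nseq (size s) (nth x0 s 0).
Proof. by case: s => // x s; rewrite rot1_cons => /rcons_cons_const /= <-. Qed.

(** * Cyclic rotation of p-tuples *)

Section Rotation.
Context (p : nat) (T : finType).
Hypothesis p_prime : prime p.

Definition rot1 (t : p.-tuple T) : p.-tuple T := [tuple of rot 1 t].

Lemma rot1_inj : injective rot1.
Proof. by move=> t u /(congr1 val) /= /rot_inj /val_inj. Qed.

Definition rot1_perm := perm rot1_inj.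

Lemma rot1_permX n t : (n <= p)%N -> val ((rot1_perm ^+ n)%g t) = rot n t.
Proof.
move=> hn; elim: n hn => [|n IH] hn; first by rewrite expg0 perm1 rot0.
rewrite expgSr permM permE /= IH ?(ltnW hn) // -rotS ?size_tuple // ltnW //.
Qed.

Lemma rot1_perm_order : (#[rot1_perm]%g %| p)%N.
Proof.
rewrite order_dvdn; apply/eqP/permP => t; apply: val_inj.
by rewrite rot1_permX // perm1 -[X in rot X](size_tuple t) rot_size.
Qed.

(** Orbit sizes divide the order of the rotation, which divides the prime [p]. *)
Lemma card_porbit_rot1 t : (#|porbit rot1_perm t| == 1)%N || (#|porbit rot1_perm t| == p)%N.
Proof.
have : (#|porbit rot1_perm t| %| p)%N.
  apply: dvdn_trans rot1_perm_order; rewrite porbitE card_orbit; exact: dvdn_indexg.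
by move/(primeP p_prime).2.
Qed.

Lemma rot1_fixed t : (#|porbit rot1_perm t| == 1)%N = (rot1 t == t).
Proof.
apply/idP/eqP => [/cards1P[u hu]|h].
  have h1 : t \in porbit rot1_perm t by rewrite porbit_id.
  have h2 : rot1_perm t \in porbit rot1_perm t by rewrite (mem_porbit _ 1).
  by move: h1 h2; rewrite hu !inE permE => /eqP-> /eqP.
have -> : porbit rot1_perm t = [set t]; last by rewrite cards1.
apply/setP => u; rewrite inE; apply/porbitP/eqP => [[i ->]|->]; last by exists 0%N; rewrite expg0 perm1.
by elim: i => [|i IH]; rewrite ?expg0 ?perm1 // expgSr permM IH permE.
Qed.

(** The counting behind the necklace proof of Fermat's theorem: the tuples fixed by rotation are the
    constant ones, and all others come in orbits of size [p]. *)
Lemma sum_tuple_rot (f : p.-tuple T -> rat) :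
  (forall t, f (rot1 t) = f t) -> (forall t, f t \is a Num.int) ->
  cong p (\sum_t f t) (\sum_(x : T) f [tuple of nseq p x]).
Proof.
move=> frot fint; have p0 := prime_gt0 p_prime.
have forb t u : porbit rot1_perm u = porbit rot1_perm t -> f u = f t.
  move/eqP; rewrite eq_porbit_mem => /porbitP[i ->].
  by elim: i => [|i IH]; rewrite ?expg0 ?perm1 // expgSr permM permE frot.
pose P t := (#|porbit rot1_perm t| == 1)%N.
have fixedE t : P t = (rot1 t == t) by exact: rot1_fixed.
rewrite (bigID P) /= -[X in cong _ _ X]addr0; apply: congD.
  pose hd (t : p.-tuple T) := tnth t (Ordinal p0).
  have constP t : P t -> [tuple of nseq p (hd t)] = t.
    rewrite fixedE => /eqP /(congr1 val) /(rot1_const (hd t)) h; apply: val_inj.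
    by rewrite /= [RHS]h size_tuple -(tnth_nth (hd t) t (Ordinal p0)).
  rewrite (reindex_onto (fun x => [tuple of nseq p x]) hd) //=.
  rewrite (eq_bigl xpredT); first exact: cong_refl.
  move=> x /=; rewrite fixedE /hd (tnth_nth x) /= nth_nseq p0 eqxx andbT.
  apply/eqP/val_inj; rewrite /= -[in LHS](prednK p0) /= rot1_cons -[in RHS](prednK p0) /=.
  by elim: p.-1 => //= m ->.
(* On each remaining orbit [f] is constant, so the orbit contributes [p] times an integer. *)
rewrite (partition_big (porbit rot1_perm) predT) //=.
rewrite -[X in cong _ _ X](_ : \sum_(A : {set p.-tuple T}) 0 = 0); last by rewrite big1.
apply: cong_sum => A _.
case: (pickP (fun t => ~~ P t && (porbit rot1_perm t == A))) => [t /andP[nP /eqP tA]|h].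
  rewrite (eq_bigl (fun u => u \in A)); last first.
    move=> u; rewrite -{2}tA -eq_porbit_mem tA; case: eqP; rewrite ?andbF // => uA.
    by rewrite /P uA -tA andbT.
  rewrite (eq_bigr (fun=> f t)); last first.
    by move=> u uA; apply: forb; apply/eqP; rewrite eq_porbit_mem tA.
  rewrite sumr_const; move: (card_porbit_rot1 t); rewrite -/(P t) (negbTE nP) /= tA => /eqP->.
  exact: cong_mulp.
by rewrite big_pred0 //; exact: cong_refl.
Qed.

End Rotation.

Section Frobenius.
Context (p : nat).
Hypothesis p_prime : prime p.
Let p_gt0 : (0 < p)%N := prime_gt0 p_prime.

Lemma congX (x y : rat) n : x \is a Num.int -> y \is a Num.int -> cong p x y ->
  cong p (x ^+ n) (y ^+ n).
Proof.
move=> ix iy h; elim: n => [|n IH]; first by rewrite !expr0; exact: cong_refl.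
by rewrite !exprS; apply: congM => //; rewrite rpredX.
Qed.

Lemma cong_fermat_nat (n : nat) : cong p (n%:R ^+ p) n%:R.
Proof.
have nn : n ^ p = n %[mod p] by exact: fermat_little.
have split m : exists2 z : rat, z \is a Num.int & m%:R = z *+ p + (m %% p)%:R :> rat.
  exists (m %/ p)%:R; first exact: rpred_nat.
  by rewrite {1}(divn_eq m p) natrD natrM mulr_natr.
have [z iz ez] := split (n ^ p)%N; have [w iw ew] := split n.
rewrite -natrX ez nn [X in cong _ _ X]ew; apply: congD; last exact: cong_refl.
apply: (cong_trans (cong_mulp p_gt0 iz)); apply: cong_sym; exact: cong_mulp.
Qed.

Lemma cong_fermat (x : rat) : x \is a Num.int -> cong p (x ^+ p) x.
Proof.
move=> /intrP[m ->].
have [n [z hn]] : exists n z, m = n%:Z + z *+ p.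
  case: m => n; first by exists n, 0; rewrite mul0rn addr0.
  (* A negative integer is made nonnegative by adding (n+1)p: -(n+1) = (n+1)(p-1) - (n+1)p. *)
  exists (n.+1 * (p - 1))%N, (- n.+1%:Z); rewrite NegzE -mulr_natr natz; move: p_gt0; nia.
have h : cong p m%:~R n%:R.
  rewrite hn intrD -[X in cong _ _ X]addr0; apply: congD; first by rewrite pmulrn; exact: cong_refl.
  by rewrite rmorphMn /=; apply: cong_mulp => //; exact: intr_int.
apply: (@cong_trans _ (n%:R ^+ p)).
  by apply: congX; rewrite ?rpred_nat.
by apply: (cong_trans (cong_fermat_nat n)); exact: cong_sym.
Qed.

(** The coefficient at z^v of the Frobenius congruence for a sum of c_i z^(e_i). Constant tuples
    survive with c_i^p, which Fermat reduces to c_i. *)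
Lemma frobenius_sum (r : nat) (I : finType) (e : I -> lat r) (c : I -> rat) (v : lat r) :
  (forall i, c i \is a Num.int) ->
  cong p (\sum_(t : p.-tuple I) (if \sum_(y <- t) e y == v then \prod_(y <- t) c y else 0))
         (\sum_(i | e i *+ p == v) c i).
Proof.
move=> ci.
pose f (t : p.-tuple I) : rat := if \sum_(y <- t) e y == v then \prod_(y <- t) c y else 0.
have frot t : f (rot1 t) = f t.
  have pr : perm_eq (rot1 t) t by rewrite /= perm_rot.
  by rewrite /f (perm_big _ pr) /= (perm_big _ pr).
have fint t : f t \is a Num.int.
  by rewrite /f; case: ifP => _; rewrite ?rpred0 // rpred_prod.
apply: (cong_trans (sum_tuple_rot p_prime frot fint)).
rewrite [X in cong _ _ X]big_mkcond; apply: cong_sum => i _.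
have iterA n : iter n (+%R (e i)) 0 = e i *+ n.
  by elim: n => //= n ->; rewrite mulrS.
have iterM n : iter n ( *%R (c i)) 1 = c i ^+ n.
  by elim: n => //= n ->; rewrite exprS.
rewrite /f /= !big_nseq iterA iterM.
by case: ifP => _; [exact: cong_fermat|exact: cong_refl].
Qed.

Lemma sum_tuple_cons (I : finType) n (f : n.+1.-tuple I -> rat) :
  \sum_t f t = \sum_(i : I) \sum_(t : n.-tuple I) f [tuple of i :: t].
Proof.
rewrite pair_big (reindex (fun x : I * n.-tuple I => [tuple of x.1 :: x.2])) //=.
exists (fun t => (thead t, [tuple of behead t])) => [[i t] _|t _] /=.
  by congr (_, _); apply: val_inj.
by apply: val_inj; case/tupleP: t => i t.
Qed.

Lemma pcoef_iter_pmul (r : nat) (I : finType) (e : I -> lat r) (c : I -> rat) n v :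
  pcoef (iter n (pmul [seq (e i, c i) | i <- enum I]) (pone r)) v =
  \sum_(t : n.-tuple I) (if \sum_(y <- t) e y == v then \prod_(y <- t) c y else 0).
Proof.
elim: n v => [|n IH] v.
  rewrite (big_pred1 [tuple]) => [|t]; last exact/esym/eqP/tuple0.
  by rewrite /= !big_nil pcoef_one eq_sym; case: eqP.
rewrite sum_tuple_cons iterS pcoef_pmul big_map big_enum; apply: eq_bigr => i _ /=.
rewrite IH mulr_sumr; apply: eq_bigr => t _.
rewrite !big_cons; have -> : (\sum_(y <- t) e y == v - e i) = (e i + \sum_(y <- t) e y == v).
  by rewrite eq_sym subr_eq eq_sym addrC.
by case: ifP => _; rewrite ?mulr0.
Qed.

End Frobenius.

(** * The Frobenius congruence for products of wall functions *)

Section WallFrobenius.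
Context (R : realType) (r : nat) (F : {set 'I_r}) (D : diagram r).
Hypothesis hD : scat_ok R F D.
Context (p : nat).
Hypothesis p_prime : prime p.
Let p_gt0 : (0 < p)%N := prime_gt0 p_prime.
Local Notation deg := (deg F).
Implicit Types (v w : lat r).

Lemma in_cone_iter (q : lpoly r) n : in_cone F q -> in_cone F (iter n (pmul q) (pone r)).
Proof.
by move=> cq; elim: n => [|n IH] /=; [exact: in_cone_one|exact: in_cone_pmul].
Qed.

Lemma iter_pmul_congr (K : int) (q q' : lpoly r) n : in_cone F q -> in_cone F q' ->
  (forall v, deg v <= K -> pcoef q v = pcoef q' v) ->
  forall v, deg v <= K ->
  pcoef (iter n (pmul q) (pone r)) v = pcoef (iter n (pmul q') (pone r)) v.
Proof.
move=> cq cq' h; elim: n => // n IH.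
by apply: (pmul_congr (F := F)) => //; exact: in_cone_iter.
Qed.

Lemma wprod_exp (a : nat -> rat) k L n v : deg v <= k%:Z ->
  pcoef (wprod D (fun i => n%:R * a i) k L) v =
  pcoef (iter n (pmul (wprod D a k L)) (pone r)) v.
Proof.
elim: n v => [|n IH] v hv.
  elim: L v hv => [|i L IHL] v hv //.
  rewrite -[RHS]pcoef_pmul1 /=.
  apply: (pmul_congr (F := F) (K := k%:Z)) => //.
  - exact: (in_cone_ptpow hD).
  - exact: (in_cone_wprod hD).
  - exact: in_cone_one.
  - exact: in_cone_one.
  move=> w hw; rewrite mul0r; case: (pselect (exists j, w = wn (dw D i) *+ j)) => [[j wj]|h].
    rewrite (pcoef_ptpow hD _ wj hw) gpow0 pcoef_one wj; congr (_%:R).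
    have w0 := wn_neq0 hD i; congr nat_of_bool; apply/eqP/eqP => [->|]; first by rewrite mulr0n.
    move=> /(congr1 deg); rewrite degMn deg0 => /eqP; rewrite mulrn_eq0 => /orP[/eqP//|].
    by rewrite gt_eqF // (deg_wn hD).
  rewrite pcoef_ptpow_not; last by move=> j e; apply: h; exists j.
  by rewrite pcoef_one; case: eqP => // w0; case: h; exists 0%N; rewrite mulr0n.
have -> : (fun i => n.+1%:R * a i) = (fun i => a i + n%:R * a i).
  by apply/funext => i; rewrite -nat1r; ring.
rewrite (wprodD hD) // iterS; apply: (pmul_congr (F := F) (K := k%:Z)) => //;
  rewrite ?in_cone_iter ?(in_cone_wprod hD) //.
Qed.

Lemma lat_mulrn_inj v w : v *+ p = w *+ p -> v = w.
Proof.
move=> h; apply/ffunP => i; have := congr1 (fun f : lat r => f i) h.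
rewrite !ffunMnE => /eqP; rewrite -subr_eq0 -mulrnBl mulrn_eq0 gtn_eqF //= subr_eq0.
by move/eqP.
Qed.

(** Multiplying all exponents by [p] raises the product to the p-th power. No two exponents have the
    same multiple by [p], so at most one term survives. *)
Lemma wprod_frobenius (a : nat -> rat) k L v : deg v <= k%:Z ->
  (forall w, deg w <= k%:Z -> pcoef (wprod D a k L) w \is a Num.int) ->
  (forall w, v = w *+ p ->
     cong p (pcoef (wprod D (fun i => p%:R * a i) k L) v) (pcoef (wprod D a k L) w)) /\
  ((forall w, v <> w *+ p) ->
     cong p (pcoef (wprod D (fun i => p%:R * a i) k L) v) 0).
Proof.
move=> hv hint; set E := wprod D a k L.
(* Integrality is assumed only up to degree [k], so [E] is replaced by its truncation [H], indexed
   by a finite type as [frobenius_sum] requires. *)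
pose S := [seq w <- undup (map fst E) | deg w <= k%:Z].
pose I := 'I_(size S); pose e (i : I) := nth 0 S i; pose c (i : I) := pcoef E (e i).
pose H : lpoly r := [seq (e i, c i) | i <- enum I].
have cE : in_cone F E by exact: (in_cone_wprod hD).
have eS i : e i \in S by rewrite mem_nth.
have cH : in_cone F H.
  apply/allP => x /mapP[i _ ->] /=; have := eS i.
  by rewrite mem_filter mem_undup => /andP[_ /mapP[y yE ->]]; exact: (in_coneP cE yE).
have uS : uniq S by rewrite filter_uniq ?undup_uniq.
have sumS (P : pred (lat r)) : \sum_(i : I | P (e i)) c i = \sum_(w <- S | P w) pcoef E w.
  by rewrite (big_nth 0) big_mkord.
have HE w : deg w <= k%:Z -> pcoef E w = pcoef H w.
  move=> hw; rewrite [RHS]pcoefE big_map big_enum -big_mkcond /= (sumS (pred1 w)).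
  have [wS|wS] := boolP (w \in S); first by rewrite -big_filter filter_pred1_uniq // big_seq1.
  rewrite big_seq_cond big_pred0 => [|u]; last first.
    by apply/negbTE/negP => /andP[uS' /eqP uw]; rewrite -uw uS' in wS.
  apply/eqP/negPn/negP => /pcoef_neq0[x xE xw]; move: wS; rewrite mem_filter hw mem_undup.
  by rewrite -xw (map_f fst xE).
have ci i : c i \is a Num.int.
  by apply: hint; have := eS i; rewrite mem_filter => /andP[].
have main : cong p (pcoef (wprod D (fun i => p%:R * a i) k L) v) (\sum_(w <- S | w *+ p == v) pcoef E w).
  rewrite wprod_exp // -/E (iter_pmul_congr _ cE cH HE hv) pcoef_iter_pmul.
  by apply: (cong_trans (frobenius_sum p_prime _ _ ci)); rewrite (sumS (fun w => w *+ p == v)); exact: cong_refl.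
split=> [w vw|nv]; apply: (cong_trans main).
  rewrite (eq_bigl (pred1 w)) => [|u /=]; last first.
    by rewrite vw; apply/eqP/eqP => [/lat_mulrn_inj|->].
  suff -> : \sum_(u <- S | pred1 w u) pcoef E u = pcoef E w by exact: cong_refl.
  have [wS|wS] := boolP (w \in S); first by rewrite -big_filter filter_pred1_uniq // big_seq1.
  rewrite big_seq_cond big_pred0 => [|u]; last first.
    by apply/negbTE/negP => /andP[uS' /eqP uw]; rewrite -uw uS' in wS.
  apply/esym/eqP/negPn/negP => /[dup] nz /pcoef_neq0[x xE xw]; move: wS.
  rewrite mem_filter mem_undup -[w in w \in _]xw (map_f fst xE) andbT => /negP; apply.
  apply: le_trans hv; rewrite vw degMn; have := deg_ge0 (pcoef_cone cE nz).
  by move=> h; rewrite -[X in X <= _]mulr1 -[_ *+ p]mulr_natr ler_wpM2l ?ler1n.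
rewrite big_pred0; first exact: cong_refl.
by move=> u; apply/negbTE/eqP => h; apply: (nv u); rewrite h.
Qed.

End WallFrobenius.

(** * Broken lines and their rescaling *)

Section Kappa.
Context (R : realType) (r : nat) (F : {set 'I_r}) (om : 'I_r -> 'I_r -> rat) (D : diagram r).
Hypothesis om_skew : forall i j, om i j = - om j i.
Hypothesis hD : scat_ok R F D.
Hypothesis bend_int_hyp : forall k, bend_int R F om D k.
Context (p : nat).
Hypothesis p_prime : prime p.
Let p_gt0 : (0 < p)%N := prime_gt0 p_prime.
Implicit Types (P Q x y : pt R r) (u v w n m : lat r) (i j k : nat) (b : bl R r).

Local Notation W := (dw D).
Local Notation cone := (cone F).
Local Notation deg := (deg F).
Local Notation act := (act F D).
Local Notation omega := (omega om).

Lemma nonsing_of_nSing P k : ~ Sing D P -> nonsing F D k P.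
Proof.
move=> h; split=> [i ai si|i j ai aj si sj]; apply: contrapT => hn; apply: h.
  by left; exists i; split=> //; exact: act_nontriv ai.
by right; exists i, j; split=> //; [exact: act_nontriv ai|exact: act_nontriv aj].
Qed.

Definition kappa P m v : rat :=
  pcoef (wprod D (fun i => `|omega m (wn (W i))|) `|deg v|%N (walls_at F D `|deg v|%N P)) v.

Lemma deg_le_abs v : deg v <= `|deg v|%N%:Z.
Proof. by rewrite abszE ler_norm. Qed.

Lemma bl_kappaE Q u b k : bl_kappa F om D Q u b k =
  kappa (bl_pos om Q u b (nth 0 b.2 k)) (bl_exp u b k) (bl_exp u b k.+1 - bl_exp u b k).
Proof.
rewrite /bl_kappa /kappa; set v := _ - _; set P := bl_pos _ _ _ _ _.
rewrite -[foldr _ _ _]/(wprod D (fun i => `|omega (bl_exp u b k) (wn (W i))|) `|deg v|%N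
   [seq i <- iota 0 (dbnd D `|deg v|%N) | in_supp (W i) P]).
rewrite (wprod_filter hD _ _ (leqnn _) (deg_le_abs v)); congr (pcoef (wprod _ _ _ _) _).
by rewrite -filter_predI.
Qed.

(** The normals at [P] are positive multiples of one direction, so the values of [omega m] on them
    share a sign; take [m] or [- m]. *)
Lemma norm_omega_walls k P m : nonsing F D k P ->
  exists n, {in walls_at F D k P, forall i, `|omega m (wn (W i))| = omega n (wn (W i))}.
Proof.
move=> [_ hP]; case E: (walls_at F D k P) => [|i0 L]; first by exists m.
have i0L : i0 \in walls_at F D k P by rewrite E mem_head.
have sgE i : i \in walls_at F D k P ->
    Num.sg (pairR (wn (W i)) (pi1 R om m)) = Num.sg (pairR (wn (W i0)) (pi1 R om m)).
  move: i0L; rewrite !mem_walls_at // => /andP[a0 s0] /andP[ai si].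
  by apply: (wn_parallel_sgr hD); exact: hP.
rewrite -E; have [h|h] := leP 0 (omega m (wn (W i0))).
  exists m => i iL; rewrite ger0_norm //; have := sgE i iL.
  by move/(congr1 (fun z => 0 <= z)); rewrite !sgr_ge0 !pairR_pi1 !ler0q h.
exists (- m) => i iL; rewrite omegaNl ltr0_norm //; have := sgE i iL.
by move/(congr1 (fun z => z < 0)); rewrite !sgr_lt0 !pairR_pi1 !ltrq0 h.
Qed.

Lemma wprod_norm_int k P m w : nonsing F D k P -> deg w <= k%:Z ->
  pcoef (wprod D (fun i => `|omega m (wn (W i))|) k (walls_at F D k P)) w \is a Num.int.
Proof.
move=> hP hw; have [n hn] := norm_omega_walls m hP.
have -> : pcoef (wprod D (fun i => `|omega m (wn (W i))|) k (walls_at F D k P)) w =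
    bend_coef F om D k P n w.
  rewrite /bend_coef /wprod; congr (pcoef (foldr _ _ _) _); apply/eq_in_map => i iL.
  by rewrite hn.
move: hw; rewrite le_eqVlt => /orP[/eqP hw|hw]; first exact: bend_int_hyp.
by apply: (bend_coef_int_lt hD) => // l _; exact: bend_int_hyp.
Qed.

Lemma kappa_int P m v : ~ Sing D P -> kappa P m v \is a Num.int.
Proof. by move=> h; apply: wprod_norm_int (deg_le_abs v); exact: nonsing_of_nSing. Qed.

Lemma kappa_frobenius P m v : ~ Sing D P ->
  (forall w, v = w *+ p -> cong p (kappa P (m *+ p) v) (kappa P m w)) /\
  ((forall w, v <> w *+ p) -> cong p (kappa P (m *+ p) v) 0).
Proof.
move=> hP; set k := `|deg v|%N.
have kE : kappa P (m *+ p) v =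
    pcoef (wprod D (fun i => p%:R * `|omega m (wn (W i))|) k (walls_at F D k P)) v.
  rewrite /kappa -/k; congr (pcoef (wprod _ _ _ _) _); apply/funext => i.
  by rewrite omegaMl normrM ger0_norm ?ler0n.
have [h1 h2] := wprod_frobenius hD p_prime (deg_le_abs v)
  (fun w hw => wprod_norm_int m (nonsing_of_nSing k hP) hw).
rewrite kE; split=> // w vw.
(* [kappa P m w] is computed at the level of [w], which is at most the level [k] of v = pw. *)
have -> : kappa P m w = pcoef (wprod D (fun i => `|omega m (wn (W i))|) k (walls_at F D k P)) w.
  rewrite /kappa; apply/esym/(wprod_walls_at hD); last exact: deg_le_abs.
  by rewrite /k vw degMn -mulr_natr abszM natz absz_nat leq_pmulr.
exact: h1.
Qed.

(** If [omega m] vanished on all normals at [P], the product would be 1. The wall obtained here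
    later determines the bend time. *)
Lemma kappa_neq0 P m v : ~ Sing D P -> v != 0 -> kappa P m v != 0 ->
  [/\ cone v & exists i, [/\ i \in walls_at F D `|deg v|%N P, omega m (wn (W i)) != 0
     & parallel v (wn (W i))]].
Proof.
move=> hP v0 hk; have hP' := nonsing_of_nSing `|deg v|%N hP.
split; first exact: (pcoef_cone (in_cone_wprod hD _ _ _) hk).
apply: contrapT => hn; move/eqP: hk; apply.
have par i : i \in walls_at F D `|deg v|%N P -> kappa P m v != 0 -> parallel v (wn (W i)).
  move=> iL; apply: wprod_supp_parallel => j; rewrite !mem_walls_at // in iL *.
  by move: iL => /andP[ai si] /andP[aj sj]; apply: (proj2 hP').
apply: contrapT => /eqP nz.
have z i : i \in walls_at F D `|deg v|%N P -> omega m (wn (W i)) = 0.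
  move=> iL; apply/eqP/negPn/negP => h; apply: hn; exists i; split=> //; exact: par.
move/eqP: nz; apply.
have -> : kappa P m v = pcoef (wprod D (fun i => 0%:R * 0) `|deg v|%N (walls_at F D `|deg v|%N P)) v.
  rewrite /kappa /wprod; congr (pcoef (foldr _ _ _) _); apply/eq_in_map => i iL.
  by rewrite z // normr0 mulr0.
by rewrite (wprod_exp hD 0) ?deg_le_abs //= pcoef_one (negbTE v0).
Qed.

End Kappa.

Section Scaling.
Context (R : realType) (r : nat) (om : 'I_r -> 'I_r -> rat) (p : nat).
Hypothesis p_prime : prime p.
Let p_gt0 : (0 < p)%N := prime_gt0 p_prime.
Implicit Types (Q : pt R r) (u v w m : lat r) (b : bl R r).

(** The velocity -pi_1(pm) is p times larger, so dividing times by [p] keeps the trajectory. *)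
Definition scale_bl b : bl R r := ([seq m *+ p | m <- b.1], [seq t / p%:R | t <- b.2]).

Definition divisible w := [forall i, (p%:Z %| w i)%Z].
Definition quot w : lat r := [ffun i => (w i %/ p%:Z)%Z].
Definition unscale_bl b : bl R r := ([seq quot m | m <- b.1], [seq t * p%:R | t <- b.2]).
Definition divisible_bl b := all divisible b.1.

Lemma quotK w : divisible w -> quot w *+ p = w.
Proof.
move=> /forallP h; apply/ffunP => i; rewrite ffunMnE ffunE -mulr_natr natz.
by rewrite divzK.
Qed.

Lemma divisibleMn w : divisible (w *+ p).
Proof. by apply/forallP => i; rewrite ffunMnE -mulr_natr natz dvdz_mull. Qed.

Let pR0 : p%:R != 0 :> R.
Proof. by rewrite pnatr_eq0 -lt0n. Qed.

Lemma unscale_blK b : divisible_bl b -> scale_bl (unscale_bl b) = b.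
Proof.
case: b => ms ts /allP h; rewrite /scale_bl /unscale_bl /=; congr (_, _).
  by rewrite -map_comp -[RHS]map_id; apply/eq_in_map => m /h /quotK.
by rewrite -map_comp -[RHS]map_id; apply: eq_map => t /=; rewrite mulfK.
Qed.

Lemma divisible_scale b : divisible_bl (scale_bl b).
Proof. by apply/allP => m /mapP[w _ ->]; exact: divisibleMn. Qed.

Lemma scale_bl_inj : injective scale_bl.
Proof.
move=> [ms ts] [ms' ts'] [h1 h2]; congr (_, _).
  by apply: inj_map h1 => m w; exact: (lat_mulrn_inj p_prime).
by apply: inj_map h2 => s t /(mulIf _); apply; rewrite invr_neq0.
Qed.

Lemma nth_map_default (T T' : Type) (f : T -> T') x0 (s : seq T) j :
  nth (f x0) (map f s) j = f (nth x0 s j).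
Proof.
by have [h|h] := ltnP j (size s); [exact: nth_map|rewrite !nth_default ?size_map].
Qed.

Lemma nth_scale_time b j : nth 0 (scale_bl b).2 j = nth 0 b.2 j / p%:R.
Proof. by rewrite -[in LHS](mul0r (p%:R^-1 : R)) (nth_map_default (fun t : R => t / p%:R)). Qed.

Lemma bl_exp_scale u b j : bl_exp (u *+ p) (scale_bl b) j = bl_exp u b j *+ p.
Proof. exact: (nth_map_default (fun m : lat r => m *+ p) u (u :: b.1)). Qed.

Lemma bl_end_scale b j : bl_end (scale_bl b) j = bl_end b j / p%:R.
Proof. by rewrite /bl_end size_map nth_scale_time; case: ifP; rewrite ?mul0r. Qed.

Lemma bl_len_scale b j (t : R) : bl_len (scale_bl b) j t = bl_len b j (t * p%:R) / p%:R.
Proof.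
have pi : 0 <= p%:R^-1 :> R by rewrite invr_ge0 ler0n.
rewrite /bl_len !bl_end_scale !nth_scale_time; case: eqP => _.
  by rewrite maxr_pMl // mul0r mulrBl mulfK.
by rewrite maxr_pMl // mul0r mulrBl maxr_pMl // mulfK.
Qed.

Lemma bl_pos_scale Q u b (t : R) : bl_pos om Q (u *+ p) (scale_bl b) t = bl_pos om Q u b (t * p%:R).
Proof.
apply/funext => i; rewrite /bl_pos size_map; congr (_ + _); apply: eq_bigr => j _.
rewrite bl_len_scale bl_exp_scale /pi1.
have -> : pi1Q om (bl_exp u b j *+ p) i = p%:R * pi1Q om (bl_exp u b j) i.
  rewrite /pi1Q mulr_sumr; apply: eq_bigr => l _; rewrite ffunMnE rmorphMn /=.
  by rewrite -[_ *+ p]mulr_natl mulrA.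
by rewrite rmorphM /= ratr_nat mulrA divfK.
Qed.

End Scaling.

Lemma cong_prod (p : nat) (I : Type) (s : seq I) (f g : I -> rat) :
  (forall i, f i \is a Num.int) -> (forall i, g i \is a Num.int) ->
  (forall i, cong p (f i) (g i)) -> cong p (\prod_(i <- s) f i) (\prod_(i <- s) g i).
Proof.
move=> hf hg h; elim: s => [|i s IH]; rewrite ?big_nil ?big_cons; first exact: cong_refl.
by apply: congM => //; exact: rpred_prod.
Qed.

Lemma finite_bounded_seqs (T : choiceType) (A : set T) (N : nat) : finite_set A ->
  finite_set [set s : seq T | (size s <= N)%N /\ forall x, x \in s -> A x].
Proof.
move=> fA; elim: N => [|N IH].
  apply: (@sub_finite_set _ _ [set [::]]); last exact: finite_set1.
  by move=> s /= [h _]; apply/nilP; rewrite /nilp -leqn0.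
apply: (@sub_finite_set _ _ ([set [::]] `|` (fun x => x.1 :: x.2) @`
  (A `*` [set s : seq T | (size s <= N)%N /\ forall x, x \in s -> A x]))%classic).
  move=> [|x s] /= [hs h]; first by left.
  right; exists (x, s) => //=; split=> /=; first by apply: h; rewrite mem_head.
  by split=> // y ys; apply: h; rewrite in_cons ys orbT.
by rewrite finite_setU; split; [exact: finite_set1|apply/finite_image/finite_setX].
Qed.

Lemma finite_lat_box (r : nat) (u v : lat r) :
  finite_set [set m : lat r | forall i, u i <= m i <= v i].
Proof.
pose N := \max_i `|v i - u i|%N.
pose f (g : {ffun 'I_r -> 'I_N.+1}) : lat r := [ffun i => u i + (g i : nat)%:Z].
apply: (@sub_finite_set _ _ (f @` [set: {ffun 'I_r -> 'I_N.+1}])%classic); last first.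
  by apply: finite_image; exact: finite_finset.
move=> m /= h; exists [ffun i => inord `|m i - u i|%N] => //.
apply/ffunP => i; have /andP[h1 h2] := h i; rewrite !ffunE inordK.
  by rewrite gez0_abs ?subr_ge0 // addrCA subrr addr0.
rewrite ltnS; apply: leq_trans (leq_bigmax i).
by rewrite -lez_nat !gez0_abs ?subr_ge0 ?lerB // (le_trans h1).
Qed.

(** * Bend times recovered from positions *)

Section BendPositions.
Context (R : realType) (r : nat) (om : 'I_r -> 'I_r -> rat).
Implicit Types (Q : pt R r) (u v w n m : lat r) (b : bl R r).

Definition well_timed b := [/\ size b.2 = size b.1, sorted <%R b.2 & all (fun t : R => t < 0) b.2].

Lemma bl_end_mono b j l : well_timed b -> (j <= l)%N -> bl_end b j <= bl_end b l.
Proof.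
move=> [sz srt neg] jl; rewrite /bl_end.
have neg' i : (i < size b.1)%N -> nth 0 b.2 i <= 0.
  by move=> hi; apply/ltW; apply: (allP neg); rewrite mem_nth // sz.
case: ifP => hj; case: ifP => hl //; last 2 first.
- exact: neg'.
- by move: hj hl; lia.
move: jl; rewrite leq_eqVlt => /orP[/eqP->//|jl]; apply/ltW.
by apply: (sorted_ltn_nth lt_trans 0 srt) => //; rewrite inE sz.
Qed.

(** [bl_len b l t] is the time spent on piece [l] after [t]. At the end of piece [j] the later
    pieces lie wholly ahead, and the others are finished. *)
Lemma bl_len_bend b j l : well_timed b -> (j < size b.1)%N -> (l <= size b.1)%N ->
  bl_len b l (nth 0 b.2 j) = if (j < l)%N then bl_end b l - bl_end b l.-1 else 0.
Proof.
move=> wt js ls; have ej : nth 0 b.2 j = bl_end b j by rewrite /bl_end js.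
rewrite /bl_len ej; case: l ls => [|l] ls /=.
  by apply/max_idPl; rewrite subr_le0; exact: bl_end_mono.
have el : nth 0 b.2 l = bl_end b l by rewrite /bl_end ls.
rewrite el ltnS; case: leqP => jl.
  rewrite (max_idPr (bl_end_mono wt jl)); apply/max_idPr.
  by rewrite subr_ge0; exact: bl_end_mono.
apply/max_idPl; rewrite subr_le0 le_max; apply/orP; left; exact: bl_end_mono.
Qed.

Lemma pairR_bl_bend Q u b j n : well_timed b -> (j < size b.1)%N ->
  pairR n (bl_pos om Q u b (nth 0 b.2 j)) = pairR n Q +
  \sum_(l < (size b.1).+1) (if (j < l)%N then bl_end b l - bl_end b l.-1 else 0) *
     ratr (omega om (bl_exp u b l) n).
Proof.
move=> wt js; rewrite /bl_pos {1}/pairR.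
under eq_bigr do rewrite mulrDr; rewrite big_split /=; congr (_ + _).
under eq_bigr do rewrite mulr_sumr; rewrite exchange_big; apply: eq_bigr => l _ /=.
rewrite -pairR_pi1 /pairR mulr_sumr; apply: eq_bigr => i _.
have hl : (l <= size b.1)%N by rewrite -ltnS.
by rewrite (bl_len_bend wt js hl) mulrCA.
Qed.

(** With the later times fixed, the pairing of the bend point with [n] is affine in the bend time,
    with slope a nonzero multiple of [omega] of the next exponent and [n]. *)
Lemma bend_time_unique Q u b b' j n : well_timed b -> well_timed b' -> b.1 = b'.1 ->
  (j < size b.1)%N -> (forall l, (j < l)%N -> bl_end b l = bl_end b' l) ->
  omega om (bl_exp u b j.+1) n != 0 ->
  pairR n (bl_pos om Q u b (nth 0 b.2 j)) = 0 ->
  pairR n (bl_pos om Q u b' (nth 0 b'.2 j)) = 0 ->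
  bl_end b j = bl_end b' j.
Proof.
move=> wt wt' e1 js hl hn h h'.
have js' : (j < size b'.1)%N by rewrite -e1.
have ee l : bl_exp u b' l = bl_exp u b l by rewrite /bl_exp e1.
move: h h'; rewrite !pairR_bl_bend // -!e1 => h h'.
have e : \sum_(l < (size b.1).+1) (if (j < l)%N then bl_end b l - bl_end b l.-1 else 0) *
     (ratr (omega om (bl_exp u b l) n) : R) =
  \sum_(l < (size b.1).+1) (if (j < l)%N then bl_end b' l - bl_end b' l.-1 else 0) *
     ratr (omega om (bl_exp u b' l) n).
  by apply: (addrI (pairR n Q)); rewrite h h'.
have j1 : (j.+1 < (size b.1).+1)%N by [].
move: e; rewrite (bigD1 (Ordinal j1)) //= [RHS](bigD1 (Ordinal j1)) //= ltnSn.
rewrite (_ : \sum_(i < _ | i != Ordinal j1) _ = \sum_(i < (size b.1).+1 | i != Ordinal j1)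
   (if (j < i)%N then bl_end b' i - bl_end b' i.-1 else 0) * ratr (omega om (bl_exp u b' i) n)).
  move/addIr; rewrite hl // ee.
  move/mulIf => /(_ _)/subrI; apply; by rewrite fmorph_eq0.
apply: eq_bigr => l ln; rewrite ee; case: ifP => // jl.
have jl' : (j < l.-1)%N by move: ln jl; rewrite -val_eqE /=; lia.
by rewrite !hl.
Qed.

End BendPositions.

Section BrokenLines.
Context (R : realType) (r : nat) (F : {set 'I_r}) (om : 'I_r -> 'I_r -> rat) (D : diagram r).
Hypothesis om_skew : forall i j, om i j = - om j i.
Hypothesis hD : scat_ok R F D.
Hypothesis bend_int_hyp : forall k, bend_int R F om D k.
Context (Q : pt R r).
Implicit Types (P x y : pt R r) (u v w n m : lat r) (i j k : nat) (b : bl R r).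

Local Notation W := (dw D).
Local Notation cone := (cone F).
Local Notation deg := (deg F).
Local Notation omega := (omega om).
Local Notation pos := (bl_pos om Q).
Local Notation kappa := (kappa F om D).
Local Notation coef := (bl_coef F om D Q).

(* Unlike [bl_valid], this does not ask for nonzero bend coefficients, a
   condition which is not stable under rescaling by [p]. *)
Definition bl_path u b := [/\ well_timed b,
  forall k, (k < size b.1)%N -> bl_exp u b k.+1 != bl_exp u b k
  & forall t, t <= 0 -> ~ Sing D (pos u b t)].

Lemma bl_validE u b : bl_valid F om D Q u b <->
  bl_path u b /\ forall k, (k < size b.1)%N -> bl_kappa F om D Q u b k != 0.
Proof.
split=> [[h1 h2 h3 h4 h5]|[[[h1 h2 h3] h4 h5] h6]].
  by split=> [|k /h4[]//]; split=> // k /h4[].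
by split=> // k hk; split; [exact: h4|exact: h6].
Qed.

Lemma bend_nSing u b k : bl_path u b -> (k < size b.1)%N -> ~ Sing D (pos u b (nth 0 b.2 k)).
Proof.
move=> [[sz _ neg] _ h] hk; apply: h; apply/ltW/(allP neg).
by rewrite mem_nth // sz.
Qed.

Lemma bl_kappa_int u b k : bl_path u b -> (k < size b.1)%N ->
  bl_kappa F om D Q u b k \is a Num.int.
Proof.
move=> hb hk; rewrite (bl_kappaE _ hD); apply: kappa_int => //; exact: bend_nSing.
Qed.

Lemma bl_coef_int u b : bl_path u b -> coef u b \is a Num.int.
Proof. by move=> hb; apply: rpred_prod => k _; exact: bl_kappa_int. Qed.

Lemma bl_coef_invalid u b : bl_path u b -> ~ bl_valid F om D Q u b -> coef u b = 0.
Proof.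
move=> hb hv; apply/eqP/negPn/negP => h; apply: hv; apply/bl_validE; split=> // k hk.
apply/negP => /eqP e; move/eqP: h; apply.
by rewrite /bl_coef (bigD1 (Ordinal hk)) //= e mul0r.
Qed.

Lemma valid_increment u b k : bl_valid F om D Q u b -> (k < size b.1)%N ->
  cone (bl_exp u b k.+1 - bl_exp u b k) /\ bl_exp u b k.+1 - bl_exp u b k != 0.
Proof.
move=> /bl_validE[hb hk] ks; have ne := let: And3 _ h _ := hb in h k ks.
split; last by rewrite subr_eq0.
have := hk k ks; rewrite (bl_kappaE _ hD) => nz.
have ne' : bl_exp u b k.+1 - bl_exp u b k != 0 by rewrite subr_eq0.
by have [] := kappa_neq0 hD (bend_nSing hb ks) ne' nz.
Qed.

(** Each bend adds a nonzero cone vector, of degree at least 1. The final exponent thus bounds the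
    number of bends and all intermediate exponents. *)
Lemma valid_monotone u b k l : bl_valid F om D Q u b -> (k <= l)%N -> (l <= size b.1)%N ->
  cone (bl_exp u b l - bl_exp u b k) /\ (l - k)%N%:Z <= deg (bl_exp u b l - bl_exp u b k).
Proof.
move=> hb; elim: l => [|l IH] kl ls.
  by move: kl; rewrite leqn0 => /eqP->; rewrite subrr subnn cone0 deg0.
move: kl; rewrite leq_eqVlt => /orP[/eqP->|kl]; first by rewrite subrr subnn cone0 deg0.
have [c1 d1] := IH kl (ltnW ls); have [c2 n2] := valid_increment hb ls.
have d2 := deg_gt0 c2 n2.
have e : bl_exp u b l.+1 - bl_exp u b k =
   (bl_exp u b l.+1 - bl_exp u b l) + (bl_exp u b l - bl_exp u b k) by rewrite addrA subrK.
rewrite e coneD // degD; split=> //; rewrite subSn //; lia.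
Qed.

(** The increment is parallel to the normal, so [omega] with the normal is the same before and after
    the bend; [bend_time_unique] uses the value after it. *)
Lemma valid_bend_wall u b k : bl_valid F om D Q u b -> (k < size b.1)%N ->
  exists i, [/\ (i < dbnd D `|deg (bl_exp u b k.+1 - bl_exp u b k)%R|%N)%N,
    pairR (wn (W i)) (pos u b (nth 0 b.2 k)) = 0 & omega (bl_exp u b k.+1) (wn (W i)) != 0].
Proof.
move=> hv ks; have [c ne] := valid_increment hv ks.
have /bl_validE[hb hk] := hv; have := hk k ks; rewrite (bl_kappaE _ hD) => nz.
have [_ [i [hi ho par]]] := kappa_neq0 hD (bend_nSing hb ks) ne nz.
move: hi; rewrite mem_walls_at // => /andP[/(act_lt hD) ilt /andP[/eqP z _]].
exists i; split=> //.
have -> : bl_exp u b k.+1 = (bl_exp u b k.+1 - bl_exp u b k) + bl_exp u b k by rewrite subrK.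
by rewrite omegaDl (omega_parallel om_skew par) add0r.
Qed.

Context (p : nat).
Hypothesis p_prime : prime p.
Let p_gt0 : (0 < p)%N := prime_gt0 p_prime.

Lemma bl_path_scale u b : bl_path (u *+ p) (scale_bl p b) <-> bl_path u b.
Proof.
have pR : 0 < p%:R :> R by rewrite ltr0n.
have pi : 0 < p%:R^-1 :> R by rewrite invr_gt0.
have srt : sorted <%R (scale_bl p b).2 = sorted <%R b.2.
  rewrite sorted_map; apply: eq_sorted => s t /=; by rewrite ltr_pM2r.
have neg : all (fun t : R => t < 0) (scale_bl p b).2 = all (fun t : R => t < 0) b.2.
  rewrite all_map; apply: eq_all => t /=; by rewrite pmulr_llt0.
have wt : well_timed (scale_bl p b) <-> well_timed b.
  by rewrite /well_timed srt neg !size_map.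
have ex k : (bl_exp (u *+ p) (scale_bl p b) k.+1 != bl_exp (u *+ p) (scale_bl p b) k) =
    (bl_exp u b k.+1 != bl_exp u b k).
  rewrite !bl_exp_scale; congr negb; apply/eqP/eqP => [|->//]; exact: (lat_mulrn_inj p_prime).
split=> [[/wt h1 h2 h3]|[/wt h1 h2 h3]]; split=> //.
- by move=> k hk; rewrite -ex h2 // size_map.
- move=> t ht; have := h3 (t / p%:R); rewrite (bl_pos_scale om p_prime) divfK ?gt_eqF //.
  by apply; rewrite pmulr_lle0.
- by move=> k; rewrite size_map ex; exact: h2.
- by move=> t ht; rewrite (bl_pos_scale om p_prime); apply: h3; rewrite pmulr_lle0.
Qed.

Lemma bl_coef_scale u b : bl_path u b -> cong p (coef (u *+ p) (scale_bl p b)) (coef u b).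
Proof.
move=> hb; have hb' : bl_path (u *+ p) (scale_bl p b) by apply/bl_path_scale.
rewrite /bl_coef size_map.
apply: cong_prod => k; first by apply: bl_kappa_int; rewrite ?size_map.
  exact: bl_kappa_int.
rewrite !(bl_kappaE _ hD) nth_scale_time (bl_pos_scale om p_prime) divfK; last first.
  by rewrite pnatr_eq0 -lt0n.
rewrite !bl_exp_scale -mulrnBl.
have hS := bend_nSing hb (ltn_ord k).
have [h _] := kappa_frobenius hD bend_int_hyp p_prime (bl_exp u b k)
  ((bl_exp u b k.+1 - bl_exp u b k) *+ p) hS.
exact: h.
Qed.

(** At the first bend reaching an exponent outside pN, the previous exponent is in pN and the
    increment is not, so this factor is 0 modulo [p] while the others are integers. *)
Lemma bl_coef_nondivisible u b : bl_path (u *+ p) b -> ~~ divisible_bl p b ->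
  cong p (coef (u *+ p) b) 0.
Proof.
move=> hb; rewrite /divisible_bl -has_predC => hnd.
pose k := find (predC (divisible p)) b.1.
have hk : (k < size b.1)%N by rewrite -has_find.
have nd : ~~ divisible p (bl_exp (u *+ p) b k.+1).
  by rewrite /bl_exp /= -[~~ _]/(predC (divisible p) _) nth_find.
have [m hm] : exists m, bl_exp (u *+ p) b k = m *+ p.
  case e : k => [|k']; first by exists u.
  exists (quot p (nth (u *+ p) b.1 k')); rewrite quotK //.
  apply/negPn/negP => h; have := @before_find _ (u *+ p) (predC (divisible p)) b.1 k'.
  by rewrite -/k e ltnSn => /(_ isT) /=; rewrite h.
rewrite /bl_coef (bigD1 (Ordinal hk)) //= -[X in cong _ _ X](mul0r 0).
set rest := \prod_(_ < _ | _) _.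
have irest : rest \is a Num.int by apply: rpred_prod => l _; exact: bl_kappa_int.
rewrite -[X in cong _ _ X](_ : 0 * rest = 0 * 0); last by rewrite !mul0r.
apply: congM; rewrite ?rpred0 //; last exact: cong_refl.
rewrite (bl_kappaE _ hD) hm.
apply: (proj2 (kappa_frobenius hD bend_int_hyp p_prime m _ (bend_nSing hb hk))).
move=> w /eqP; rewrite subr_eq -mulrnDl => /eqP e.
by move: nd; rewrite e divisibleMn.
Qed.

End BrokenLines.

Lemma fsbig_uniq_seq (T : choiceType) (A : set T) (s : seq T) (f : T -> rat) :
  uniq s -> (forall x, x \in s -> A x) -> (forall x, A x -> x \notin s -> f x = 0) ->
  \sum_(x \in A) f x = \sum_(x <- s) f x.
Proof.
move=> us sA h; rewrite (@fsbigE _ _ _ _ _ s) // big_seq_cond [RHS]big_seq.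
by apply: eq_bigl => x; rewrite andb_idr // => /sA /mem_set.
Qed.

(** * Theta functions *)

Section Theta.
Context (R : realType) (r : nat) (F : {set 'I_r}) (om : 'I_r -> 'I_r -> rat) (D : diagram r).
Hypothesis om_skew : forall i j, om i j = - om j i.
Hypothesis hD : scat_ok R F D.
Hypothesis bend_int_hyp : forall k, bend_int R F om D k.
Context (p : nat).
Hypothesis p_prime : prime p.
Let p_gt0 : (0 < p)%N := prime_gt0 p_prime.
Context (Q : pt R r).
Implicit Types (P x y : pt R r) (u v w n m : lat r) (j k : nat) (b : bl R r).

Local Notation W := (dw D).
Local Notation cone := (cone F).
Local Notation deg := (deg F).
Local Notation omega := (omega om).
Local Notation pos := (bl_pos om Q).
Local Notation coef := (bl_coef F om D Q).
Local Notation valid := (bl_valid F om D Q).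
Local Notation path := (bl_path om D Q).
Local Notation theta := (theta_coef F om D Q).

Definition valid_lines u v : set (bl R r) :=
  [set b : bl R r | valid u b /\ bl_exp u b (size b.1) = v].

Lemma cone_le n m : cone (m - n) -> forall i, n i <= m i.
Proof. by move=> /coneP[h _] i; have := h i; rewrite !ffunE subr_ge0. Qed.

(* A broken line is determined by its exponents and the walls where it bends:
   the bend times are recovered one after the other, backwards from [Q]. *)
Lemma finite_valid_lines u v : finite_set (valid_lines u v).
Proof.
(* [N] bounds the number of bends and the degree of each increment, hence [B] the index of a wall
   responsible for a bend. *)
pose N := `|deg (v - u)%R|%N; pose B := \max_(k < N.+1) dbnd D k.
pose PW b k := [set i : nat | [/\ (i < B)%N, pairR (wn (W i)) (pos u b (nth 0 b.2 k)) = 0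
  & omega (bl_exp u b k.+1) (wn (W i)) != 0]]%classic.
pose wl b k : nat := xget 0%N (PW b k).
have wlP b k : valid_lines u v b -> (k < size b.1)%N -> PW b k (wl b k).
  move=> [hb hv] ks; apply: xgetPex.
  have [i [i1 i2 i3]] := valid_bend_wall om_skew hD hb ks; exists i; split=> //.
  have [c1 _] := valid_monotone hD hb (leq0n k) (ltnW ks).
  have [c2 _] := valid_increment hD hb ks.
  have [c3 _] := valid_monotone hD hb ks (leqnn _).
  have e : v - u = (bl_exp u b (size b.1) - bl_exp u b k.+1) +
     ((bl_exp u b k.+1 - bl_exp u b k) + (bl_exp u b k - bl_exp u b 0)).
    by rewrite -hv [X in _ = _ + X]addrA subrK addrA subrK.
  have le : (`|deg (bl_exp u b k.+1 - bl_exp u b k)%R| < N.+1)%N.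
    rewrite ltnS /N e !degD; have := deg_ge0 c1; have := deg_ge0 c2; have := deg_ge0 c3.
    by rewrite !degD; lia.
  exact: leq_trans i1 (leq_bigmax (Ordinal le)).
pose g b := (b.1, mkseq (wl b) (size b.1)).
have ginj : {in valid_lines u v &, injective g}.
  move=> b b' /set_mem hb /set_mem hb' [e1 e2].
  have wt : well_timed b by have [/bl_validE[[]]] := hb.
  have wt' : well_timed b' by have [/bl_validE[[]]] := hb'.
  have ew k : (k < size b.1)%N -> wl b k = wl b' k.
    by move=> ks; rewrite -(nth_mkseq 0%N (wl b) ks) e2 nth_mkseq -?e1.
  (* [m] counts the bends already recovered, starting from [Q]. *)
  have ends (m : nat) j : (size b.1 - m <= j)%N -> bl_end b j = bl_end b' j.
    elim: m j => [|m IH] j hj.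
      by rewrite /bl_end -e1 ltnNge (leq_trans _ hj) ?subn0.
    have [hs|js] := leqP (size b.1) j; first by apply: IH; rewrite (leq_trans (leq_subr _ _)).
    have [_ z nz] := wlP b j hb js.
    have js' : (j < size b'.1)%N by rewrite -e1.
    have [_ z' _] := wlP b' j hb' js'; rewrite -(ew _ js) in z'.
    apply: (bend_time_unique wt wt' e1 js _ nz z z') => l jl.
    by apply: IH; lia.
  case: b b' e1 hb hb' wt wt' ends {e2 ew} => [ms ts] [ms' ts'] /= -> _ _ [/= s1 _ _] [/= s2 _ _] ends.
  congr (_, _); apply: (@eq_from_nth _ 0); first by rewrite s1 s2.
  move=> j js; rewrite s1 in js.
  by have := ends (size ms') j; rewrite subnn => /(_ isT); rewrite /bl_end /= js.
rewrite -(eq_finite_set (inj_card_eq ginj)).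
apply: (@sub_finite_set _ _ ([set s : seq (lat r) | (size s <= N)%N /\ forall m, m \in s -> [set m : lat r | forall i, u i <= m i <= v i] m]
  `*` [set s : seq nat | (size s <= N)%N /\ forall i, i \in s -> `I_B i])%classic).
  move=> _ [b hb <-] /=.
  have [hv ev] := hb.
  have sz : (size b.1 <= N)%N.
    have [_] := valid_monotone hD hv (leq0n _) (leqnn (size b.1)).
    by rewrite ev subn0 /N /bl_exp /=; lia.
  split=> /=; split; rewrite ?size_mkseq //.
    move=> m mb i; have hk : (index m b.1 < size b.1)%N by rewrite index_mem.
    have em : bl_exp u b (index m b.1).+1 = m by rewrite /bl_exp /= nth_index.
    have [c1 _] := valid_monotone hD hv (leq0n _) hk.
    have [c3 _] := valid_monotone hD hv hk (leqnn _).
    by rewrite em in c1 c3; rewrite ev in c3; rewrite (cone_le c1) (cone_le c3).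
  by move=> i /mapP[k]; rewrite mem_iota => /andP[_ hk] ->; have [] := wlP b k hb hk.
apply: finite_setX; apply: finite_bounded_seqs; [exact: finite_lat_box|exact: finite_II].
Qed.

Definition in_ker u := [forall j, pi1Q om u j == 0].

Lemma theta_ker u v : in_ker u -> theta u v = (v == u)%:R.
Proof. by rewrite /theta_coef /in_ker => ->. Qed.

(** Paths that are not valid have coefficient 0, so the list may be enlarged freely, as the
    comparison of rescaled lines requires. *)
Lemma theta_sum u v (s : seq (bl R r)) : ~~ in_ker u -> uniq s ->
  (forall b, b \in s -> path u b /\ bl_exp u b (size b.1) = v) ->
  (forall b, valid_lines u v b -> b \in s) ->
  theta u v = \sum_(b <- s) coef u b.
Proof.
move=> hu us hs hv; rewrite /theta_coef -/(in_ker u) (negbTE hu).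
rewrite (@fsbig_uniq_seq _ _ [seq b <- s | `[< valid_lines u v b >]]) ?filter_uniq //.
- rewrite big_filter [RHS](bigID (fun b => `[< valid_lines u v b >])) /=.
  rewrite [X in _ = _ + X]big_seq_cond [X in _ = _ + X]big1 ?addr0 //.
  move=> b /andP[/hs[hb e] /asboolP nv]; apply: (bl_coef_invalid hb) => h; apply: nv; by split.
- by move=> b /=; rewrite mem_filter => /andP[/asboolP].
- by move=> b hb; rewrite mem_filter (hv _ hb) andbT => /asboolP[].
Qed.

Lemma valid_path u b : valid u b -> path u b.
Proof. by case/bl_validE. Qed.

Lemma valid_lines_seq u v : exists s : seq (bl R r), [/\ uniq s,
  (forall b, b \in s -> path u b /\ bl_exp u b (size b.1) = v) &
  (forall b, valid_lines u v b -> b \in s)].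
Proof.
have /finite_seqP[s hs] := finite_valid_lines u v.
have mem b : valid_lines u v b <-> b \in s by rewrite hs.
exists (undup s); split; rewrite ?undup_uniq // => b; rewrite mem_undup.
  by move=> /mem[h e]; split=> //; exact: valid_path.
by move=> /mem.
Qed.

Lemma theta_int u v : theta u v \is a Num.int.
Proof.
have [hu|hu] := boolP (in_ker u); first by rewrite theta_ker // rpred_nat.
have [s [us hs hv]] := valid_lines_seq u v.
rewrite (theta_sum hu us hs hv) big_seq; apply: rpred_sum => b /hs[hb _].
exact: (bl_coef_int hD).
Qed.

Lemma theta_support u v : theta u v != 0 -> cone (v - u).
Proof.
have [hu|hu] := boolP (in_ker u).
  by rewrite theta_ker //; case: (v =P u) => [-> _|_]; rewrite ?subrr ?cone0 ?eqxx.
have [s [us hs hv]] := valid_lines_seq u v.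
move=> nz; case: (pselect (exists b, valid_lines u v b)) => [[b [hb <-]]|h].
  by have [] := valid_monotone hD hb (leq0n _) (leqnn _).
move/eqP: nz; case; rewrite (theta_sum hu us hs hv) big_seq big1 // => b /hs[hb e].
by apply: (bl_coef_invalid hb) => vb; apply: h; exists b.
Qed.

Lemma in_ker_scale u : in_ker (u *+ p) = in_ker u.
Proof.
apply: eq_forallb => j.
have -> : pi1Q om (u *+ p) j = p%:R * pi1Q om u j.
  rewrite /pi1Q mulr_sumr; apply: eq_bigr => l _; rewrite ffunMnE rmorphMn /=.
  by rewrite -[_ *+ p]mulr_natl mulrA.
by rewrite mulf_eq0 pnatr_eq0 gtn_eqF.
Qed.

Lemma theta_scale_divisible u w : cong p (theta (u *+ p) (w *+ p)) (theta u w).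
Proof.
have [hu|hu] := boolP (in_ker u).
  rewrite !theta_ker ?in_ker_scale //.
  have -> : (w *+ p == u *+ p) = (w == u); last exact: cong_refl.
  by apply/eqP/eqP => [|->//]; exact: (lat_mulrn_inj p_prime).
have [s1 [us1 hs1 hv1]] := valid_lines_seq u w.
have [s2 [us2 hs2 hv2]] := valid_lines_seq (u *+ p) (w *+ p).
have hu' : ~~ in_ker (u *+ p) by rewrite in_ker_scale.
(* Of two congruent coefficients one may vanish and the other be a nonzero multiple of [p], so
   neither scaling nor unscaling preserves validity. The list [s] therefore also takes the paths
   whose rescalings are valid for pu. *)
pose s := undup (s1 ++ [seq unscale_bl p b | b <- s2 & divisible_bl p b]).
have hs b : b \in s -> path u b /\ bl_exp u b (size b.1) = w.
  rewrite mem_undup mem_cat => /orP[/hs1//|/mapP[b' + ->]].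
  rewrite mem_filter => /andP[db /hs2[hb e]].
  rewrite -(unscale_blK p_prime db) in hb e; split; first by apply/(bl_path_scale om D Q p_prime).
  by move: e; rewrite size_map bl_exp_scale; exact: (lat_mulrn_inj p_prime).
have hv b : valid_lines u w b -> b \in s by move=> /hv1; rewrite mem_undup mem_cat => ->.
pose s' := [seq scale_bl p b | b <- s] ++ [seq b <- s2 | ~~ divisible_bl p b].
have us' : uniq s'.
  rewrite cat_uniq (map_inj_uniq (scale_bl_inj p_prime)) undup_uniq filter_uniq // andbT /=.
  apply/hasPn => b; rewrite mem_filter => /andP[nd _].
  by apply/negP => /mapP[b' _ e]; move: nd; rewrite e divisible_scale.
have hs' b : b \in s' -> path (u *+ p) b /\ bl_exp (u *+ p) b (size b.1) = w *+ p.
  rewrite mem_cat => /orP[/mapP[b' /hs[hb e] ->]|]; last by rewrite mem_filter => /andP[_ /hs2].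
  by split; [apply/(bl_path_scale om D Q p_prime)|rewrite size_map bl_exp_scale e].
have hv' b : valid_lines (u *+ p) (w *+ p) b -> b \in s'.
  move=> /hv2 bs2; rewrite mem_cat mem_filter bs2 andbT.
  case db: (divisible_bl p b); rewrite ?orbT //= orbF.
  apply/mapP; exists (unscale_bl p b); last by rewrite (unscale_blK p_prime db).
  by rewrite mem_undup mem_cat; apply/orP; right; apply: map_f; rewrite mem_filter db.
rewrite (theta_sum hu' us' hs' hv') (theta_sum hu (undup_uniq _) hs hv) big_cat big_map.
rewrite -[X in cong _ _ X]addr0; apply: congD.
  rewrite big_seq [X in cong _ _ X]big_seq; apply: cong_sum => b /hs[hb _].
  exact: (bl_coef_scale hD).
rewrite big_filter -[X in cong _ _ X](_ : \sum_(b <- s2 | ~~ divisible_bl p b) 0 = 0); last by rewrite big1.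
rewrite big_seq_cond [X in cong _ _ X]big_seq_cond; apply: cong_sum => b /andP[/hs2[hb _] nd].
exact: (bl_coef_nondivisible hD).
Qed.

Lemma theta_scale_nondivisible u v : (forall w, v <> w *+ p) -> cong p (theta (u *+ p) v) 0.
Proof.
move=> nv; have [hu|hu] := boolP (in_ker u).
  rewrite theta_ker ?in_ker_scale //; case: eqP => [/nv//|_]; exact: cong_refl.
have [s2 [us2 hs2 hv2]] := valid_lines_seq (u *+ p) v.
have hu' : ~~ in_ker (u *+ p) by rewrite in_ker_scale.
rewrite (theta_sum hu' us2 hs2 hv2) -[X in cong _ _ X](_ : \sum_(b <- s2) 0 = 0); last by rewrite big1.
rewrite big_seq [X in cong _ _ X]big_seq; apply: cong_sum => b /hs2[hb e].
apply: (bl_coef_nondivisible hD) => //; apply/negP => /allP db.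
move: e; case: b {hb} db => [ms ts] /=; rewrite /bl_exp /=.
case: ms => [|m ms] db e; first by apply: (nv u); rewrite -e.
have hm : nth (u *+ p) (m :: ms) (size ms) \in m :: ms by rewrite mem_nth.
by apply: (nv (quot p v)); rewrite -e /= quotK // db.
Qed.

Lemma theta_pow_cong u v : cong p (theta_pow_coef F om D Q u p v) (theta (u *+ p) v).
Proof.
(* Each exponent of theta_u is [u] plus a nonnegative vector. If [p] of them add up to [v], these
   vectors add up to v - pu, so each lies in the box of size [B], a finite type. *)
pose B := \max_i `|(v - u *+ p)%R i|%N.
pose I := {ffun 'I_r -> 'I_B.+1}; pose e (f : I) : lat r := u + [ffun i => (f i : nat)%:Z].
have einj : injective e.
  move=> f g /addrI /ffunP h; apply/ffunP => i; apply: val_inj.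
  by have := h i; rewrite !ffunE => -[].
have erange (y : lat r) : (forall i, 0 <= y i - u i) -> (forall i, y i - u i <= (v - u *+ p) i) ->
    exists f, y = e f.
  move=> h1 h2; exists [ffun i => inord `|y i - u i|%N]; apply/ffunP => i; rewrite !ffunE inordK.
    by rewrite gez0_abs // addrCA subrr addr0.
  rewrite ltnS; apply: leq_trans (leq_bigmax i).
  by have := h1 i; have := h2 i; set z := (v - u *+ p) i; lia.
have powE : theta_pow_coef F om D Q u p v =
    \sum_(t : p.-tuple I) (if \sum_(y <- t) e y == v then \prod_(y <- t) theta u (e y) else 0).
  pose s := [seq map_tuple e t | t <- enum [pred t : p.-tuple I | \sum_(y <- t) e y == v]].
  have us : uniq s.
    rewrite map_inj_uniq ?enum_uniq // => t t' /(congr1 val) /= /(inj_map einj) h.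
    exact: val_inj.
  rewrite /theta_pow_coef (@fsbig_uniq_seq _ _ s) //.
  - rewrite big_map big_enum /= big_mkcond /=.
    by apply: eq_bigr => t _; rewrite big_map.
  - by move=> x /= /mapP[t]; rewrite mem_enum inE => /eqP h ->; rewrite /= big_map.
  move=> x /= hx nx; apply/eqP/negPn/negP => nz; move/negP: nx; apply.
  have hsup (y : lat r) : y \in x -> forall i, 0 <= y i - u i.
    move=> yx i; have ty : theta u y != 0.
      apply: contraNneq nz => h; rewrite (big_rem y) //= h mul0r //.
    have /coneP[h _] := theta_support ty; by have := h i; rewrite !ffunE.
  have hb (y : lat r) : y \in x -> forall i, y i - u i <= (v - u *+ p) i.
    move=> yx i.
    have -> : (v - u *+ p) i = \sum_(z <- x) (z i - u i).
      rewrite sumrB -hx !ffunE ffunMnE; congr (_ - _).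
        by elim: (tval x) => [|z l IH]; rewrite ?big_nil ?big_cons ?ffunE // IH.
      by rewrite big_const_seq count_predT size_tuple iter_addr_0.
    rewrite (big_rem y) //= lerDl big_seq sumr_ge0 // => z /mem_rem zx; exact: hsup.
  pose e' (y : lat r) : I := if pselect (exists f, y = e f) is left h then projT1 (cid h) else [ffun=> ord0].
  have e'K (y : lat r) : y \in x -> e (e' y) = y.
    move=> yx; rewrite /e'; case: pselect => [h|h]; first by rewrite -(projT2 (cid h)).
    by case: h; apply: erange; [exact: hsup|exact: hb].
  have ex : map e (map e' x) = x by rewrite -map_comp map_id_in // => y /e'K.
  apply/mapP; exists (map_tuple e' x); last by apply: val_inj; rewrite /= ex.
  by rewrite mem_enum inE /= -(big_map e xpredT id) ex hx.
rewrite powE; apply: (cong_trans (frobenius_sum p_prime e v (fun f => theta_int u (e f)))).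
case: (pselect (exists w, v = w *+ p)) => [[w vw]|h]; last first.
  rewrite big_pred0; first by apply/cong_sym/theta_scale_nondivisible => w vw; apply: h; exists w.
  by move=> f; apply/negbTE/eqP => ef; apply: h; exists (e f).
rewrite {2}vw; apply: (@cong_trans _ (theta u w)); last exact/cong_sym/theta_scale_divisible.
have pE f : (e f *+ p == v) = (e f == w).
  by rewrite vw; apply/eqP/eqP => [|->//]; exact: (lat_mulrn_inj p_prime).
under eq_bigl do rewrite pE.
case: (pselect (exists f, w = e f)) => [[f wf]|h].
  rewrite (big_pred1 f) -?wf => [|g]; first exact: cong_refl.
  by rewrite wf (inj_eq einj).
rewrite big_pred0 => [|f]; last by apply/negbTE/eqP => ef; apply: h; exists f.
suff -> : theta u w = 0 by exact: cong_refl.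
apply/eqP/negPn/negP => nz; apply: h.
have /coneP[hc _] := theta_support nz.
have hc' i : 0 <= w i - u i by have := hc i; rewrite !ffunE.
(* Coordinatewise, w - u is nonnegative and so at most p(w - u) = v - pu; thus [w] lies in the
   box. *)
apply: erange => // i; rewrite vw !ffunE !ffunMnE -mulNrn -mulrnDl -[_ *+ p]mulr_natr.
by rewrite ler_peMr // ler1n.
Qed.

End Theta.

Theorem mainTheorem8 (R : realType) (r : nat) (F : {set 'I_r})
    (om : 'I_r -> 'I_r -> rat) (d : 'I_r -> rat) :
  (forall i j, om i j = - om j i) ->
  (forall i, 0 < d i) ->
  (forall i j, exists z : int, d i * om i j = z%:~R) ->
  forall D : diagram r,
    scat_ok R F D -> consistent R F om D -> contains_init_outgoing R F om d D ->
  forall p : nat, prime p ->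
  forall (u : lat r) (Q : pt R r), Q_generic D Q ->
  forall v : lat r, exists z : int,
    theta_pow_coef F om D Q u p v - theta_coef F om D Q (u *+ p) v
      = (p%:Z * z)%:~R.
Proof.
move=> om_skew _ dom_int D hD hcons [ix [_ ix_init out]] p p_prime u Q _ v.
have hint k : bend_int R F om D k.
  exact: (bend_int_all om_skew dom_int hD hcons ix_init out).
have := theta_pow_cong om_skew hD hint p_prime Q u v.
rewrite /cong => /intrP[z hz]; exists z.
have p0 : p%:R != 0 :> rat by rewrite pnatr_eq0 -lt0n prime_gt0.
by rewrite intrM mulrC -hz divfK.
Qed.
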